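(* The morphism $$\varphi=\prod_i\varphi_i:\tilde G\longrightarrow\prod_i \mathrm{O}(\bar V_i,\bar q_i)^{\mathrm{red}}$$ is surjective.
   Context: Let $F$ be a finite unramified extension of $\mathbb{Q}_2$, $A$ its ring of integers and $\kappa=A/2A$. Let $L$ be a free $A$-module of rank $n$ with a quadratic form $q:L\to A$, $\langle x,y\rangle=\frac12(q(x+y)-q(x)-q(y))$, nondegenerate on $V=L\otimes_AF$, with $\langle L,L\rangle\subseteq A$. For a lattice $M\subset V$ put $M^{\perp}=\{x\in V:\langle x,M\rangle\subseteq A\}$. For each $i\ge0$ let $A_i=\{x\in L:\langle x,L\rangle\subseteq 2^iA\}$, $b_i=2^{-i}\langle-,-\rangle\bmod 2$ on $A_i/2A_i$; $X_i$ with $X_i/2A_i$ the radical of $b_i$; $B_i$ with $B_i/2A_i$ the kernel of $x\mapsto 2^{-i}q(x)\bmod 2$; $e\in A_i/X_i$ the unique vector with $b_i(v,e)^2=2^{-i}q(v)\bmod 2$ for all $v$, and $W_i$ the preimage of $\kappa e$; $Y_i$ with $Y_i/2A_i$ the radical of $b_i$ on $B_i/2A_i$; $Z_i$ with $Z_i/2A_i=\{x\in Y_i/2A_i:2^{-i-1}q(x)\equiv0\bmod 2\}$. Let $\bar V_i=B_i/Z_i$ with the nonsingular quadratic form $\bar q_i$ induced by $2^{-i-1}q\bmod 2$. For flat $R$, $M_R=M\otimes_AR$. $\underline M(R)$ is the set of $m\in\mathrm{End}_R(L_R)$ stabilizing $(A_i)_R,(B_i)_R,(W_i)_R,(X_i)_R,(Y_i)_R,(Z_i)_R$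 for all $i$ with $m-1$ mapping $(A_i)_R\to(B_i)_R$, $(W_i)_R\to(X_i\cap Z_i)_R$, $((X_i\cap Z_i)^\perp)_R\to(W_i^\perp)_R$; this is represented by an affine space over $A$ with coordinate ring $A(\underline M)$; $\underline M^*=\mathrm{Spec}\,A(\underline M)_{\det}$; $\underline G\subset\underline M^*$ the stabilizer of $q$; $\tilde G=\underline G\otimes_A\kappa$ its special fiber. Since $\underline G$ stabilizes $B_i,Z_i$ and preserves $\bar q_i$, the induced action gives a morphism of algebraic groups over $\kappa$, $\varphi_i:\tilde G\to\mathrm{O}(\bar V_i,\bar q_i)^{\mathrm{red}}$, where $\mathrm{O}(\bar V_i,\bar q_i)^{\mathrm{red}}$ is the reduced subgroup scheme of the orthogonal group of $(\bar V_i,\bar q_i)$. *)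

(* Defs.v *)
From HB Require Import structures.
From mathcomp Require Import all_boot all_order all_algebra all_field.
From mathcomp Require Import mpoly.

Set Implicit Arguments.
Unset Strict Implicit.
Unset Printing Implicit Defensive.

Import Order.TTheory GRing.Theory Num.Theory.
Local Open Scope ring_scope.

Definition abs2 (r : rat) : rat :=
  if r == 0 then 0
  else 2 ^+ logn 2%N `|denq r|%N / 2 ^+ logn 2%N `|numq r|%N.

(* (K, nrm) is the completion of the rationals for the 2-adic absolute value,
   i.e. K = Q_2.  All values of nrm are 0 or powers of 2, hence rational. *)
Record is_Q2 (K : fieldType) (nrm : K -> rat) : Prop := IsQ2 {
  Q2_ge0 : forall x, 0 <= nrm x;
  Q2_eq0 : forall x, nrm x = 0 <-> x = 0;
  Q2_mul : forall x y, nrm (x * y) = nrm x * nrm y;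
  Q2_add : forall x y, nrm (x + y) <= nrm x + nrm y;
  Q2_rat : forall r : rat, nrm (ratr r) = abs2 r;
  Q2_dense : forall x (eps : rat), 0 < eps ->
    exists r : rat, nrm (x - ratr r) < eps;
  Q2_complete : forall a : nat -> K,
    (forall eps : rat, 0 < eps -> exists N, forall i j : nat,
       (N <= i)%N -> (N <= j)%N -> nrm (a i - a j) < eps) ->
    exists x, forall eps : rat, 0 < eps -> exists N, forall i : nat,
       (N <= i)%N -> nrm (a i - x) < eps }.

Definition integral_over_Z2 (K : fieldType) (nrm : K -> rat)
    (F : fieldExtType K) (x : F) : Prop :=
  exists p : {poly K},
    [/\ p \is monic, (forall j : nat, nrm p`_j <= 1)
      & root (map_poly (in_alg F) p) x].

Definition is_ring_of_integers (K : fieldType) (nrm : K -> rat)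
    (F : fieldExtType K) (A : idomainType) (iota : {rmorphism A -> F}) : Prop :=
  injective iota /\
  forall x : F, (exists a, x = iota a) <-> integral_over_Z2 nrm x.

(* For the valuation ring A of a finite extension of Q_2 (residue extensions
   are automatically separable), "unramified" says that 2 generates the
   maximal ideal, which is the set of non-units of A. *)
Definition is_unramified (A : idomainType) : Prop :=
  forall a : A, a \isn't a GRing.unit <-> exists b, a = 2 * b.

Definition is_quotient_mod2 (A : idomainType) (k : fieldType)
    (pi : {rmorphism A -> k}) : Prop :=
  (forall z : k, exists a, z = pi a) /\
  (forall a, pi a = 0 <-> exists b, a = 2 * b).

(* Equational criterion: every linear relation over A between elements of R is
   a consequence of relations holding in A. *)
Definition flat (A R : comNzRingType) (u : {rmorphism A -> R}) : Prop :=
  forall (m : nat) (a : 'rV[A]_m) (x : 'cV[R]_m),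
    map_mx u a *m x = 0 ->
    exists p (b : 'M[A]_(m, p)) (y : 'cV[R]_p),
      x = map_mx u b *m y /\ a *m b = 0.

Definition polar (A : comNzRingType) n (q : 'cV[A]_n -> A) (x y : 'cV[A]_n) : A :=
  q (x + y) - q x - q y.

Definition quadratic_form (A : comNzRingType) n (q : 'cV[A]_n -> A) : Prop :=
  [/\ forall a x, q (a *: x) = a ^+ 2 * q x,
      forall x y z, polar q (x + y) z = polar q x z + polar q y z
    & forall a x y, polar q (a *: x) y = a * polar q x y].

(* The quadratic form on R^n obtained from q by extension of scalars. *)
Definition qext (A R : comNzRingType) (u : A -> R) n (q : 'cV[A]_n -> A)
    (x : 'cV[R]_n) : R :=
  let e (j : 'I_n) : 'cV[A]_n := delta_mx j 0 in
  \sum_(j < n) u (q (e j)) * x j 0 ^+ 2 +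
  \sum_(j < n) \sum_(l < n | (j < l)%N) u (polar q (e j) (e l)) * x j 0 * x l 0.

(* L = A^n inside V = F^n; lattices of V are given as predicates on F^n. *)
Section Lattices.

Variables (F : fieldType) (A : idomainType) (iota : {rmorphism A -> F}).
Variables (n : nat) (q : 'cV[A]_n -> A).

Definition lattice := 'cV[F]_n -> Prop.

Definition inA (x : F) : Prop := exists a, x = iota a.
Definition congr2 (x y : F) : Prop := exists a, x - y = 2 * iota a.

Definition Llat : lattice := fun x => exists y : 'cV[A]_n, x = map_mx iota y.

Definition qV (x : 'cV[F]_n) : F := qext iota q x.
Definition bV (x y : 'cV[F]_n) : F := (qV (x + y) - qV x - qV y) / 2.

Definition integral_form : Prop :=
  forall x y, Llat x -> Llat y -> inA (bV x y).

Definition nondegenerate_form : Prop :=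
  forall x, (forall y, bV x y = 0) -> x = 0.

Definition dual (M : lattice) : lattice := fun x => forall y, M y -> inA (bV x y).

Definition capl (M N : lattice) : lattice := fun x => M x /\ N x.

Definition bi (i : nat) (x y : 'cV[F]_n) : F := bV x y / 2 ^+ i.
Definition qi (i : nat) (x : 'cV[F]_n) : F := qV x / 2 ^+ i.

Definition latA (i : nat) : lattice := fun x =>
  Llat x /\ forall y, Llat y -> inA (bi i x y).

Definition latX (i : nat) : lattice := fun x =>
  latA i x /\ forall y, latA i y -> congr2 (bi i x y) 0.

Definition latB (i : nat) : lattice := fun x => latA i x /\ congr2 (qi i x) 0.

Definition is_e (i : nat) (e : 'cV[F]_n) : Prop :=
  latA i e /\ forall v, latA i v -> congr2 (bi i v e ^+ 2) (qi i v).

Definition latW (i : nat) : lattice := fun x =>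
  latA i x /\ exists e (a : A), is_e i e /\ latX i (x - iota a *: e).

Definition latY (i : nat) : lattice := fun x =>
  latB i x /\ forall y, latB i y -> congr2 (bi i x y) 0.

Definition latZ (i : nat) : lattice := fun x => latY i x /\ congr2 (qi i.+1 x) 0.

Definition scaled_in_L (N : nat) (M : lattice) : Prop :=
  forall x, M x -> Llat (2 ^+ N *: x).

Section BaseChange.

Variables (R : comNzRingType) (u : {rmorphism A -> R}).

(* If 2^N M is contained in L and R is flat, this is the submodule (2^N M)_R of
   L_R = R^n, i.e. 2^N (M_R); for M contained in L and N = 0 it is M_R. *)
Definition base_change (N : nat) (M : lattice) (x : 'cV[R]_n) : Prop :=
  exists p (r : 'I_p -> R) (y : 'I_p -> 'cV[A]_n),
    (forall t, exists2 v, M v & map_mx iota (y t) = 2 ^+ N *: v) /\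
    x = \sum_t r t *: map_mx u (y t).

(* h maps (M1)_R to (M2)_R; for lattices not contained in L this is tested
   after multiplication by a power of 2, a non-zero-divisor of flat R. *)
Definition maps_to (h : 'M[R]_n) (M1 M2 : lattice) : Prop :=
  forall N, scaled_in_L N M1 -> scaled_in_L N M2 ->
  forall x, base_change N M1 x -> base_change N M2 (h *m x).

Definition Mpt (m : 'M[R]_n) : Prop :=
  forall i : nat,
    [/\ [/\ maps_to m (latA i) (latA i), maps_to m (latB i) (latB i)
          & maps_to m (latW i) (latW i)],
        [/\ maps_to m (latX i) (latX i), maps_to m (latY i) (latY i)
          & maps_to m (latZ i) (latZ i)]
      & [/\ maps_to (m - 1%:M) (latA i) (latB i),
            maps_to (m - 1%:M) (latW i) (capl (latX i) (latZ i))
          & maps_to (m - 1%:M) (dual (capl (latX i) (latZ i))) (dual (latW i))]].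

Definition Mstar_pt (m : 'M[R]_n) : Prop :=
  Mpt m /\ exists r : R, \det m * r = 1.

Definition Gpt (m : 'M[R]_n) : Prop :=
  Mstar_pt m /\ forall x, qext u q (m *m x) = qext u q x.

End BaseChange.

(* The A-algebra s : A -> AM with universal point univ represents the functor M
   on flat A-algebras; AM is the coordinate ring A(M). *)
Definition represents_M (AM : comNzRingType) (s : {rmorphism A -> AM})
    (univ : 'M[AM]_n) : Prop :=
  [/\ flat s, Mpt s univ
    & forall (R : comNzRingType) (u : {rmorphism A -> R}), flat u ->
      forall m : 'M[R]_n, Mpt u m ->
      exists f : {rmorphism AM -> R},
        [/\ f \o s =1 u, map_mx f univ = m
          & forall f' : {rmorphism AM -> R},
              f' \o s =1 u -> map_mx f' univ = m -> f' =1 f]].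

Section SpecialFiber.

Variables (AM : comNzRingType) (s : {rmorphism A -> AM}) (univ : 'M[AM]_n).

(* The ideal of the closed subscheme G of M^* (the functions on M^* vanishing on
   it, up to powers of det): G is the flat closed subscheme whose points in any
   flat A-algebra are the points of M^* stabilizing q. *)
Definition ideal_G (a : AM) : Prop :=
  forall (R : comNzRingType) (u : {rmorphism A -> R}) (f : {rmorphism AM -> R}),
    flat u -> f \o s =1 u -> Gpt u (map_mx f univ) -> f a = 0.

Variables (k : fieldType) (pi : {rmorphism A -> k}).

(* R-points of the special fiber of G, for a k-algebra w : k -> R, as
   A-algebra morphisms A(M)_det -> R killing the ideal of G. *)
Definition Gtilde_pt (R : comNzRingType) (w : {rmorphism k -> R})
    (x : {rmorphism AM -> R}) : Prop :=
  [/\ x \o s =1 w \o pi,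
      exists r : R, x (\det univ) * r = 1
    & forall a, ideal_G a -> x a = 0].

Variables (i d : nat) (beta : 'M[A]_(n, d)).

(* The columns of beta lie in B_i and represent a k-basis of B_i / Z_i. *)
Definition is_basis_Vbar : Prop :=
  [/\ forall c : 'cV[A]_d, latB i (map_mx iota (beta *m c)),
      forall x, latB i x ->
        exists c : 'cV[A]_d, latZ i (x - map_mx iota (beta *m c))
    & forall c : 'cV[A]_d, latZ i (map_mx iota (beta *m c)) ->
        map_mx pi c = 0].

(* qbar is the form induced by 2^(-i-1) q mod 2, in the coordinates of beta. *)
Definition is_qbar (qbar : 'cV[k]_d -> k) : Prop :=
  forall (c : 'cV[A]_d) (a : A),
    q (beta *m c) = 2 ^+ i.+1 * a -> qbar (map_mx pi c) = pi a.

(* g is the matrix, in the basis beta, of the automorphism of (B_i / Z_i)_R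
   induced by the point x: univ acts on (B_i)_AM / (Z_i)_AM, which is free over
   AM / 2 AM with basis beta, through a matrix c which x maps to g. *)
Definition phi_graph (R : comNzRingType) (x : {rmorphism AM -> R})
    (g : 'M[R]_d) : Prop :=
  exists c : 'M[AM]_d,
    (forall t, base_change s 0 (latZ i)
       (col t (univ *m map_mx s beta - map_mx s beta *m c))) /\
    g = map_mx x c.

End SpecialFiber.

End Lattices.

Section OrthogonalGroup.

Variables (k : fieldType) (d : nat) (qbar : 'cV[k]_d -> k).

Definition O_pt (R : comNzRingType) (w : {rmorphism k -> R}) (g : 'M[R]_d) : Prop :=
  (exists r : R, \det g * r = 1) /\
  forall x, qext w qbar (g *m x) = qext w qbar x.

Definition mx_eval (R : comNzRingType) (w : {rmorphism k -> R}) (g : 'M[R]_d)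
    (P : {mpoly k[(d * d)%N]}) : R :=
  mmap w (fun t => mxvec g 0 t) P.

(* P is nilpotent as a regular function on the orthogonal group. *)
Definition nilpotent_on_O (P : {mpoly k[(d * d)%N]}) : Prop :=
  exists N : nat, forall (R : comNzRingType) (w : {rmorphism k -> R}) (g : 'M[R]_d),
    O_pt w g -> mx_eval w g P ^+ N = 0.

(* Points of the reduced subscheme: the nilpotent functions vanish.  Functions
   are of the form P / det^N, so it suffices to test polynomials P. *)
Definition Ored_pt (R : comNzRingType) (w : {rmorphism k -> R}) (g : 'M[R]_d) : Prop :=
  O_pt w g /\ forall P, nilpotent_on_O P -> mx_eval w g P = 0.

End OrthogonalGroup.

(* Surjectivity of phi on the underlying sets of points of the two k-schemes, a
   point of a scheme being an equivalence class of field-valued points: every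
   point of the product with values in a field K over k is, over some extension
   K' of K, the image of a point of the special fiber. *)
Definition phi_surjective (F : fieldType) (A : idomainType)
    (iota : {rmorphism A -> F}) (n : nat) (q : 'cV[A]_n -> A)
    (AM : comNzRingType) (s : {rmorphism A -> AM}) (univ : 'M[AM]_n)
    (k : fieldType) (pi : {rmorphism A -> k})
    (d : nat -> nat) (beta : forall i, 'M[A]_(n, d i))
    (qbar : forall i, 'cV[k]_(d i) -> k) : Prop :=
  forall (K : fieldType) (w : {rmorphism k -> K}) (g : forall i, 'M[K]_(d i)),
    (forall i, Ored_pt (qbar i) w (g i)) ->
    exists (K' : fieldType) (j : {rmorphism K -> K'}) (x : {rmorphism AM -> K'}),
      Gtilde_pt iota q s univ pi (j \o w : {rmorphism k -> K'}) x /\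
      forall i, phi_graph iota q s univ i (beta i) x (map_mx j (g i)).

(* Main.v *)
(** Let R be a flat A-algebra and v in (B_i)_R with q(v) = 2^(i+1) * unit.  The
    reflection x |-> x - 2<x,v>/q(v) v lies in G(R): its difference with the
    identity is an R-combination of the operators x |-> b_i(x,a) a', with a and
    a' in B_i, which satisfy over A all the conditions defining M, the one on
    dual lattices by passing to the adjoint.  It acts as the reflection in the
    class of v on B_i/Z_i, and trivially on B_j/Z_j for j <> i.

    Over a field with more than two elements the orthogonal group of a
    nonsingular quadratic form in characteristic 2 is generated by reflections:
    if q(gx - x) <> 0 for some x, the reflection in gx - x enlarges the fixed
    space of g; otherwise the image of g - 1 is totally singular, and a product
    of two Siegel transformations, each of them a product of two reflections,
    enlarges it.  A point of the product of the orthogonal groups over K thus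
    becomes over K' = K(t) a product of reflections in finitely many vectors,
    which lift to the localization R of a polynomial ring A[x_1,...,x_N] at the
    kernel of an evaluation map to K'. *)

Require Import Defs.
From HB Require Import structures.
From mathcomp Require Import all_boot all_order all_algebra all_field.
From mathcomp Require Import fraction mpoly ring.
From Stdlib Require Import ClassicalEpsilon.

Set Implicit Arguments.
Unset Strict Implicit.
Unset Printing Implicit Defensive.

Import Order.TTheory GRing.Theory Num.Theory.
Local Open Scope ring_scope.

(** Four obstacles shape the proof. The reflection vectors have entries in K', but membership in G
    is tested over flat A-algebras. So R is built only once all these entries are known: it is
    torsion-free over A (hence flat, A being a valuation ring), it surjects onto the needed entries,
    and its elements of nonzero residue are invertible, which makes q(v)/2^(i+1) a unit. Next, i
    runs over all naturals, while only finitely many reflections can be multiplied: a power 2^N is a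
    multiple of the Gram determinant, and B_i/Z_i vanishes for i >= N + 2. The passage to K(t)
    serves K = F_2, where the splitting of a Siegel transformation into reflections may lack a
    scalar other than 0 and 1. Nonsingularity of the form on B_i/Z_i must survive the extension from
    kappa to K'; this comes from kappa being perfect, proved by pigeonhole. Finally, phi is read off
    from a matrix C over A(M) attached to the universal point, whereas the reflections give explicit
    matrices over R; both describe the same action modulo Z_i, and nonsingularity over K' forces
    their images there to agree. *)

(** * Localization of a domain at the kernel of a map to a field *)

Section Localization.

Variables (S : idomainType) (K : fieldType) (phi : {rmorphism S -> K}).

Definition is_local_frac (x : {fraction S}) : Prop :=
  exists ab : S * S,
    phi ab.2 != 0 /\ x * FracField.tofrac ab.2 = FracField.tofrac ab.1.

Definition local_frac : pred {fraction S} :=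
  fun x => if excluded_middle_informative (is_local_frac x) then true else false.

Lemma local_fracP x : reflect (is_local_frac x) (x \in local_frac).
Proof.
rewrite unfold_in /local_frac.
by case: excluded_middle_informative => h; constructor.
Qed.

Lemma local_frac_subring : subring_closed local_frac.
Proof.
split.
- by apply/local_fracP; exists (1, 1); rewrite rmorph1 oner_eq0 mul1r.
- move=> x y /local_fracP[[a b] /= [b0 xb]] /local_fracP[[c d] /= [d0 yd]].
  apply/local_fracP; exists (a * d - c * b, b * d) => /=; split.
    by rewrite rmorphM mulf_neq0.
  rewrite rmorphB !rmorphM /= -xb -yd; ring.
- move=> x y /local_fracP[[a b] /= [b0 xb]] /local_fracP[[c d] /= [d0 yd]].
  apply/local_fracP; exists (a * c, b * d) => /=; split.
    by rewrite rmorphM mulf_neq0.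
  rewrite !rmorphM /= -xb -yd; ring.
Qed.

HB.instance Definition _ :=
  GRing.isSubringClosed.Build {fraction S} local_frac local_frac_subring.

Record localization := LocalFrac {
  local_val : {fraction S};
  local_valP : local_val \in local_frac }.

HB.instance Definition _ := [isSub for local_val].
HB.instance Definition _ := [Choice of localization by <:].
HB.instance Definition _ := [SubChoice_isSubComNzRing of localization by <:].

Lemma local_of_proof (a : S) : FracField.tofrac a \in local_frac.
Proof.
by apply/local_fracP; exists (a, 1) => /=; rewrite !rmorph1 oner_eq0 mulr1.
Qed.

Definition local_of (a : S) : localization := LocalFrac (local_of_proof a).

Lemma local_of_zmod : zmod_morphism local_of.
Proof. by move=> a b; apply: val_inj; rewrite /= rmorphB. Qed.

Lemma local_of_monoid : monoid_morphism local_of.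
Proof. by split=> [|a b]; apply: val_inj; rewrite /= ?rmorph1 ?rmorphM. Qed.

HB.instance Definition _ :=
  GRing.isZmodMorphism.Build S localization local_of local_of_zmod.
HB.instance Definition _ :=
  GRing.isMonoidMorphism.Build S localization local_of local_of_monoid.

Lemma local_repr (x : localization) : is_local_frac (val x).
Proof. exact/local_fracP/local_valP. Qed.

Definition local_res (x : localization) : K :=
  let ab := proj1_sig (constructive_indefinite_description _ (local_repr x)) in
  phi ab.1 / phi ab.2.

(** Two fractions for [x] have equal cross products in [S], so [phi] gives them the same quotient
    and the choice made in [local_res] does not matter. *)
Lemma local_resE (x : localization) (a b : S) :
  phi b != 0 -> val x * FracField.tofrac b = FracField.tofrac a ->
  local_res x = phi a / phi b.
Proof.
move=> b0 xb; rewrite /local_res.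
case: constructive_indefinite_description => -[c d] /= [d0 xd].
apply/eqP; rewrite eqr_div // -!rmorphM; apply/eqP; congr (phi _).
by apply/eqP; rewrite -tofrac_eq !rmorphM /= -xb -xd mulrAC.
Qed.

Lemma local_res_zmod : zmod_morphism local_res.
Proof.
move=> x y; have [[a b] /= [b0 xb]] := local_repr x.
have [[c d] /= [d0 yd]] := local_repr y.
rewrite (local_resE b0 xb) (local_resE d0 yd).
rewrite (@local_resE _ (a * d - c * b) (b * d)).
- by rewrite rmorphB !rmorphM; field; rewrite b0 d0.
- by rewrite rmorphM mulf_neq0.
- by rewrite [LHS]/= rmorphB !rmorphM /= -xb -yd; ring.
Qed.

Lemma local_res_monoid : monoid_morphism local_res.
Proof.
split=> [|x y].
  by rewrite (@local_resE _ 1 1) ?divff // ?rmorph1 ?oner_eq0 // mul1r.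
have [[a b] /= [b0 xb]] := local_repr x.
have [[c d] /= [d0 yd]] := local_repr y.
rewrite (local_resE b0 xb) (local_resE d0 yd).
rewrite (@local_resE _ (a * c) (b * d)).
- by rewrite !rmorphM; field; rewrite b0 d0.
- by rewrite rmorphM mulf_neq0.
- by rewrite [LHS]/= !rmorphM /= -xb -yd; ring.
Qed.

HB.instance Definition _ :=
  GRing.isZmodMorphism.Build localization K local_res local_res_zmod.
HB.instance Definition _ :=
  GRing.isMonoidMorphism.Build localization K local_res local_res_monoid.

Lemma local_res_of a : local_res (local_of a) = phi a.
Proof.
have e1 : phi 1 != 0 by rewrite rmorph1 oner_eq0.
by rewrite (@local_resE _ a 1) // ?rmorph1 ?divr1 // mulr1.
Qed.

Lemma local_of_reg (a : S) (y : localization) :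
  a != 0 -> local_of a * y = 0 -> y = 0.
Proof.
move=> a0 /(congr1 val) /= /eqP; rewrite mulf_eq0 tofrac_eq0 (negbTE a0) /=.
by move/eqP=> y0; apply: val_inj.
Qed.

Lemma local_res_unit (x : localization) :
  local_res x != 0 -> exists y, x * y = 1.
Proof.
have [[a b] /= [b0 xb]] := local_repr x.
rewrite (local_resE b0 xb) mulf_eq0 negb_or => /andP[a0 _].
have a0' : FracField.tofrac a != 0.
  by rewrite tofrac_eq0; apply: contraNneq a0 => ->; rewrite rmorph0.
have yP : (FracField.tofrac b / FracField.tofrac a) \in local_frac.
  by apply/local_fracP; exists (b, a); split=> //=; rewrite divfK.
exists (LocalFrac yP); apply: val_inj => /=.
by rewrite mulrA xb divff.
Qed.

End Localization.

(** * Matrices, ranks and bilinear forms *)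

Lemma matrix_ext_col (R : comNzRingType) m n (M M' : 'M[R]_(m, n)) :
  (forall x : 'cV_n, M *m x = M' *m x) -> M = M'.
Proof.
move=> e; apply/matrixP => i j.
have /matrixP/(_ i 0) := e (delta_mx j 0).
by rewrite -!colE !mxE.
Qed.

(** Applied to [g - 1] and [g' - 1], when [g'] fixes every vector fixed by [g] and one more. The
    kernel inclusion, tested on the cokernel matrix of [M], becomes an inclusion of row spaces. *)
Lemma rank_lt_of_ker (K : fieldType) m (M M' : 'M[K]_m) (x : 'cV_m) :
  (forall y : 'cV_m, M *m y = 0 -> M' *m y = 0) -> M' *m x = 0 -> M *m x != 0 ->
  (\rank M' < \rank M)%N.
Proof.
move=> sub M'x Mx; apply: rank_ltmx; rewrite ltmxE; apply/andP; split.
  rewrite submxE; apply/eqP/matrix_ext_col => y; rewrite mul0mx -mulmxA.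
  by apply: sub; rewrite mulmxA mulmx_coker mul0mx.
by apply: contra Mx => /submxP[D ->]; rewrite -mulmxA M'x mulmx0.
Qed.

Definition bilin (R : comNzRingType) m (H : 'M[R]_m) (x y : 'cV[R]_m) : R :=
  (x^T *m H *m y) 0 0.

Section Bilin.

Variables (R : comNzRingType) (m : nat) (H : 'M[R]_m).
Local Notation B := (bilin H).

Lemma bilinDl x y z : B (x + y) z = B x z + B y z.
Proof. by rewrite /bilin linearD /= !mulmxDl mxE. Qed.

Lemma bilinDr x y z : B z (x + y) = B z x + B z y.
Proof. by rewrite /bilin mulmxDr mxE. Qed.

Lemma bilinZl a x z : B (a *: x) z = a * B x z.
Proof. by rewrite /bilin linearZ /= -!scalemxAl mxE. Qed.

Lemma bilinZr a x z : B z (a *: x) = a * B z x.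
Proof. by rewrite /bilin -scalemxAr mxE. Qed.

Lemma bilinNl x z : B (- x) z = - B x z.
Proof. by rewrite -scaleN1r bilinZl mulN1r. Qed.

Lemma bilinNr x z : B z (- x) = - B z x.
Proof. by rewrite -scaleN1r bilinZr mulN1r. Qed.

Lemma bilin0l x : B 0 x = 0.
Proof. by rewrite -(scale0r 0) bilinZl mul0r. Qed.

Lemma bilin0r x : B x 0 = 0.
Proof. by rewrite -(scale0r 0) bilinZr mul0r. Qed.

Definition bilinE := (bilinDl, bilinDr, bilinNl, bilinNr, bilinZl, bilinZr).

Lemma bilin_sym x y : H^T = H -> B x y = B y x.
Proof.
move=> Hs; rewrite /bilin -[in RHS](trmxK (y^T *m H *m x)) [in RHS]mxE.
by rewrite !trmx_mul trmxK Hs mulmxA.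
Qed.

Lemma rank1_mul (v x y : 'cV[R]_m) : v *m (x^T *m H) *m y = B x y *: v.
Proof.
by rewrite -mulmxA [x^T *m H *m y]mx11_scalar mul_mx_scalar.
Qed.

Lemma bilin_deltal l y : B (delta_mx l 0) y = (H *m y) l 0.
Proof. by rewrite /bilin trmx_delta -rowE -row_mul mxE. Qed.

Lemma bilin_coll d (M : 'M[R]_(m, d)) t y :
  B (col t M) y = (M^T *m H *m y) t 0.
Proof. by rewrite /bilin tr_col -!row_mul mxE. Qed.

End Bilin.

(** * Generation of the orthogonal group by reflections in characteristic 2 *)

Section Reflections.

Variables (K : fieldType) (d : nat) (H : 'M[K]_d) (Q : 'cV[K]_d -> K).
Hypothesis char2 : 2 = 0 :> K.
Hypothesis nontrivial : exists t : K, t != 0 /\ t != 1.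
Local Notation B := (bilin H).
Hypothesis QD : forall x y, Q (x + y) = Q x + Q y + B x y.
Hypothesis QZ : forall a x, Q (a *: x) = a ^+ 2 * Q x.
Hypothesis nonsing : forall x, (forall y, B x y = 0) -> Q x = 0 -> x = 0.

Definition refl (v : 'cV[K]_d) : 'M[K]_d :=
  1%:M - (Q v)^-1 *: (v *m (v^T *m H)).

Inductive refl_gen : 'M[K]_d -> Prop :=
| refl_gen1 : refl_gen 1%:M
| refl_genM v g : Q v != 0 -> refl_gen g -> refl_gen (refl v *m g).

Lemma refl_gen_refl v : Q v != 0 -> refl_gen (refl v).
Proof.
by move=> Qv; rewrite -[refl v]mulmx1; apply: refl_genM => //; apply: refl_gen1.
Qed.

Lemma refl_gen_mul g h : refl_gen g -> refl_gen h -> refl_gen (g *m h).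
Proof.
move=> gg gh; elim: gg => [|v g' Qv _ IH]; first by rewrite mul1mx.
by rewrite -mulmxA; apply: refl_genM.
Qed.

Let add_self (x : K) : x + x = 0.
Proof. by rewrite -[x + x]mulr2n -mulr_natr char2 mulr0. Qed.

Let opp_id (x : K) : - x = x.
Proof. by apply/eqP; rewrite eq_sym -subr_eq0 opprK add_self. Qed.

Let oppv_id (x : 'cV[K]_d) : - x = x.
Proof. by apply/matrixP => i j; rewrite mxE opp_id. Qed.

Let addv_self (x : 'cV[K]_d) : x + x = 0.
Proof. by rewrite -[X in X + _]oppv_id addNr. Qed.

Lemma polarC x y : B x y = B y x.
Proof.
have := QD x y; rewrite addrC QD [Q y + _]addrC => /addrI.
by move=> ->.
Qed.

Lemma polar_self x : B x x = 0.
Proof.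
have := QD x x; rewrite -[x + x]mulr2n -scaler_nat QZ char2 expr0n mul0r.
by rewrite add_self add0r => <-.
Qed.

Lemma quad0 : Q 0 = 0.
Proof. by rewrite -(scale0r 0) QZ expr0n mul0r. Qed.

Lemma reflE v x : refl v *m x = x + (B v x / Q v) *: v.
Proof.
rewrite /refl mulmxBl mul1mx -scalemxAl rank1_mul scalerA [_^-1 * _]mulrC.
by rewrite oppv_id.
Qed.

Lemma reflK v : Q v != 0 -> refl v *m refl v = 1%:M.
Proof.
move=> Qv; apply: matrix_ext_col => x; rewrite -mulmxA !reflE !bilinE.
rewrite polar_self mulr0 addr0 -addrA -scalerDl add_self scale0r addr0.
by rewrite mul1mx.
Qed.

Lemma exists_polar_ne0 u : u != 0 -> Q u = 0 -> exists y, B u y != 0.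
Proof.
move=> u0 Qu; have [/eqP e|] := boolP (u^T *m H == 0).
  case/eqP: u0; apply: nonsing => // y.
  by rewrite /bilin e mul0mx mxE.
case/matrix0Pn => i [j]; rewrite ord1 => h.
by exists (delta_mx j 0); rewrite /bilin -colE mxE.
Qed.

(** The Siegel (or Eichler) transformation, with signs dropped; it is an isometry when [Q u = 0] and
    [B u w = 0]. *)
Definition siegel (u w : 'cV[K]_d) : 'M[K]_d :=
  1%:M + u *m (w^T *m H) + w *m (u^T *m H) + Q w *: (u *m (u^T *m H)).

Lemma siegelE u w x :
  siegel u w *m x = x + B w x *: u + B u x *: w + (Q w * B u x) *: u.
Proof.
by rewrite /siegel !mulmxDl mul1mx -scalemxAl !rank1_mul scalerA.
Qed.

Lemma siegel_refl_gen u w : Q u = 0 -> B u w = 0 -> Q w != 0 ->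
  refl_gen (siegel u w).
Proof.
move=> Qu Buw Qw; have Qw' : Q (w + Q w *: u) = Q w.
  by rewrite QD QZ Qu bilinE polarC Buw !mulr0 !addr0.
suff -> : siegel u w = refl w *m refl (w + Q w *: u).
  by apply: refl_genM => //; apply: refl_gen_refl; rewrite Qw'.
apply: matrix_ext_col => x; rewrite -mulmxA !reflE Qw' siegelE !bilinE.
rewrite polar_self [B w u]polarC Buw mulr0 addr0 mulr0 addr0.
apply/matrixP => i j; rewrite !mxE.
set bw := B w x; set bu := B u x; set c := Q w.
(* The product of the two reflections differs from the Siegel transformation by a doubled multiple
   of [w]. *)
have -> : x i j + (bw + c * bu) / c * (w i j + c * u i j) + bw / c * w i j =
   x i j + bw * u i j + bu * w i j + c * bu * u i j + 2 * (bw / c * w i j).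
  by field; rewrite Qw.
by rewrite char2 mul0r addr0.
Qed.

Lemma siegelM u w w' : Q u = 0 -> B u w = 0 -> B u w' = 0 ->
  siegel u w *m siegel u w' = siegel u (w + w').
Proof.
move=> Qu Buw Buw'; apply: matrix_ext_col => x.
rewrite -mulmxA !siegelE !bilinE QD polar_self [B w u]polarC Buw Buw'.
by apply/matrixP => i j; rewrite !mxE; ring.
Qed.

(** As [u2] is singular, [siegel_refl_gen] does not apply directly. By additivity in the second
    vector, [u2] is split into two nonsingular vectors orthogonal to [u1]. *)
Lemma siegel_gen u1 u2 x : Q u1 = 0 -> Q u2 = 0 -> B u1 u2 = 0 ->
  B u1 x = 0 -> B u2 x != 0 -> refl_gen (siegel u1 u2).
Proof.
move=> Q1 Q2 B12 B1x B2x.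
have [w0 [B1w Qw0]] : exists w, B u1 w = 0 /\ Q w != 0.
  have [Qx|] := eqVneq (Q x) 0; last by exists x.
  exists (x + u2); rewrite bilinE B1x B12 addr0; split=> //.
  by rewrite QD Qx Q2 !add0r polarC.
(* [Q (u2 + t *: w0)] equals [t * (t * Q w0 + B u2 w0)]. The scalar 1 works unless [Q w0 = B u2 w0],
   and then any scalar other than 0 and 1 does. *)
have [t [t0 ht]] : exists t, t != 0 /\ t * Q w0 != B u2 w0.
  have [e|ne] := eqVneq (Q w0) (B u2 w0); last first.
    by exists 1; rewrite oner_eq0 mul1r.
  have [t [t0 t1]] := nontrivial; exists t; split=> //.
  by apply: contra t1 => /eqP; rewrite -e -{2}[Q w0]mul1r => /(mulIf Qw0) ->.
have -> : u2 = t *: w0 + (u2 + t *: w0) by rewrite addrCA addv_self addr0.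
rewrite -siegelM //; last 2 first.
- by rewrite bilinE B1w mulr0.
- by rewrite !bilinE B12 B1w mulr0 addr0.
apply: refl_gen_mul; apply: siegel_refl_gen; rewrite ?bilinE ?B12 ?B1w //.
- by rewrite mulr0.
- by rewrite QZ mulf_neq0 ?expf_neq0.
- by rewrite mulr0 addr0.
- rewrite QD Q2 add0r QZ bilinE expr2 -mulrA -mulrDr mulf_neq0 //.
  by rewrite -[B u2 w0]opp_id subr_eq0.
Qed.

Lemma isometry_polar (g : 'M[K]_d) : (forall x, Q (g *m x) = Q x) ->
  forall x y, B (g *m x) (g *m y) = B x y.
Proof.
move=> gQ x y; have := gQ (x + y); rewrite mulmxDr !QD !gQ.
by move/addrI.
Qed.

Theorem isometry_refl_gen (g : 'M[K]_d) :
  (forall x, Q (g *m x) = Q x) -> refl_gen g.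
Proof.
have [r] := ubnP (\rank (g - 1%:M)); elim: r g => // r IH g; rewrite ltnS => ltr gQ.
have gB := isometry_polar gQ.
pose N (x : 'cV[K]_d) := g *m x + x.
have NE x : (g - 1%:M) *m x = N x by rewrite mulmxBl mul1mx oppv_id.
have gN x : g *m x = x + N x by rewrite /N addrCA addv_self addr0.
(* Expanding [Q (x + N x) = Q x]. This identity is why the reflection in [N x] sends [g *m x] back
   to [x]. *)
have NB x : Q (N x) = B (N x) x.
  have := gQ x; rewrite {1}gN QD -addrA -[RHS]addr0 => /addrI /eqP.
  by rewrite addr_eq0 opp_id polarC => /eqP.
have Nfix x y : N y = 0 -> B (N x) y = 0.
  move=> Ny; have gy : g *m y = y by rewrite gN Ny addr0.
  by rewrite /N bilinE -{1}gy gB add_self.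
have ND x y : N (x + y) = N x + N y by rewrite /N mulmxDr addrACA.
clearbody N.
have [[x Qx]|allQ] := excluded_middle_informative (exists x, Q (N x) != 0).
  have -> : g = refl (N x) *m (refl (N x) *m g) by rewrite mulmxA reflK // mul1mx.
  apply: refl_genM => //; apply: IH; last first.
    move=> y; rewrite -mulmxA reflE QD QZ gQ bilinE [B _ (N x)]polarC.
    set b := B _ _; set c := Q (N x).
    have -> : Q y + (b / c) ^+ 2 * c + b / c * b = Q y + 2 * (b ^+ 2 / c).
      by field; rewrite Qx.
    by rewrite char2 mul0r addr0.
  apply: leq_trans ltr; apply: (@rank_lt_of_ker _ _ _ _ x).
  - move=> y; rewrite NE mulmxBl mul1mx -mulmxA reflE => Ny.
    by rewrite gN Ny addr0 Nfix // mul0r scale0r addr0 subrr.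
  - rewrite mulmxBl mul1mx -mulmxA reflE gN bilinE polar_self addr0 NB.
    by rewrite divff -?NB // scale1r -[x + _ + _]addrA addv_self addr0 subrr.
  - by rewrite NE; apply: contra Qx => /eqP ->; rewrite quad0.
have {}allQ x : Q (N x) = 0.
  by apply/eqP/negPn/negP => h; apply: allQ; exists x.
have NNB x y : B (N x) (N y) = 0.
  by have := QD (N x) (N y); rewrite -ND !allQ !add0r.
have [/eqP g1|g1] := boolP (g - 1%:M == 0).
  by move/eqP: g1; rewrite subr_eq0 => /eqP ->; apply: refl_gen1.
have [x Nx] : exists x, N x != 0.
  case/matrix0Pn: g1 => i [j gij]; exists (delta_mx j 0).
  by rewrite -NE -colE; apply/matrix0Pn; exists i, 0; rewrite mxE.
have [y0 By0] := exists_polar_ne0 Nx (allQ x).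
pose y := (B (N x) y0)^-1 *: y0.
have Bxy : B (N x) y = 1 by rewrite bilinE mulVf.
clearbody y.
(* Polarizing [NB] on a totally singular image gives [B (N x) y = B (N y) x] in characteristic 2. *)
have Byx : B (N y) x = 1.
  have := NB (x + y).
  rewrite allQ ND !bilinE -!NB !allQ add0r addr0 Bxy => /esym/eqP.
  by rewrite addr_eq0 opp_id => /eqP.
set u1 := N x in Nx Bxy *; set u2 := N y in Byx *.
have E2 : siegel u1 u2 *m siegel u1 u2 = 1%:M.
  rewrite siegelM ?allQ ?NNB // addv_self; apply: matrix_ext_col => z.
  by rewrite siegelE bilin0l quad0 mul0r scale0r scaler0 !addr0 mul1mx.
have -> : g = siegel u1 u2 *m (siegel u1 u2 *m g) by rewrite mulmxA E2 mul1mx.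
(* For [z = x] the term [B u2 x *: u1] cancels [N x], and [B u1 x = Q u1 = 0]; for a fixed vector
   [z] of [g], all three corrections vanish. *)
have sE z : siegel u1 u2 *m (g *m z) = z + N z + B u2 z *: u1 + B u1 z *: u2.
  by rewrite siegelE allQ mul0r scale0r addr0 gN !bilinE !NNB !addr0.
apply: refl_gen_mul.
  apply: (@siegel_gen _ _ x); rewrite ?allQ ?NNB //.
    by rewrite -NB allQ.
  by rewrite Byx oner_eq0.
apply: IH; last first.
  move=> z; rewrite -mulmxA siegelE allQ mul0r scale0r addr0.
  rewrite !QD !QZ !allQ gQ !bilinE NNB ![B _ u1]polarC ![B _ u2]polarC !mulr0 !addr0.
  set b := B _ _; set c := B _ _.
  by rewrite [c * b]mulrC -addrA add_self addr0.
apply: leq_trans ltr; apply: (@rank_lt_of_ker _ _ _ _ x).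
- move=> z; rewrite NE mulmxBl mul1mx -mulmxA sE => Nz.
  by rewrite Nz !Nfix // !scale0r !addr0 subrr.
- rewrite mulmxBl mul1mx -mulmxA sE Byx scale1r -NB allQ scale0r addr0.
  by rewrite -[in X in X - _]addrA addv_self addr0 subrr.
- by rewrite NE.
Qed.

End Reflections.

(** * The valuation ring A and its residue field *)

Section Dyadic.

Variables (Q2 : fieldType) (nrm : Q2 -> rat) (hQ2 : is_Q2 nrm).

Lemma nrm0 : nrm 0 = 0.
Proof. exact/(Q2_eq0 hQ2). Qed.

Lemma nrm_rat (r : rat) : nrm (ratr r) = abs2 r.
Proof. exact: (Q2_rat hQ2). Qed.

Lemma nrm_int (m : int) : nrm m%:~R = abs2 m%:~R.
Proof. by rewrite -nrm_rat /ratr numq_int denq_int divr1. Qed.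

Lemma nrm1 : nrm 1 = 1.
Proof. exact: (nrm_int 1). Qed.

Lemma nrm_two : nrm 2 = 1 / 2.
Proof. exact: (nrm_int 2). Qed.

Lemma nrmN1 : nrm (-1) = 1.
Proof. exact: (nrm_int (-1)). Qed.

Lemma Q2_int_neq0 (m : int) : m != 0 -> m%:~R != 0 :> Q2.
Proof.
move=> m0; apply/eqP => /(congr1 nrm); rewrite nrm0 nrm_int /abs2 intr_eq0.
rewrite (negbTE m0) => /eqP; rewrite mulf_eq0 invr_eq0 !expf_eq0.
by rewrite !andbF.
Qed.

Lemma Q2_two_neq0 : 2 != 0 :> Q2.
Proof. exact: (@Q2_int_neq0 2). Qed.

Lemma nrmN x : nrm (- x) = nrm x.
Proof. by rewrite -mulN1r (Q2_mul hQ2) nrmN1 mul1r. Qed.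

(** Nonzero values of [abs2] are powers of 2, so the bound 2 already forces an odd denominator; the
    slack above 1 absorbs the ordinary triangle inequality in [residue_Z2]. *)
Lemma abs2_lt2 (r : rat) : abs2 r < 2 -> ~~ (2 %| `|denq r|)%N.
Proof.
move=> lt2; apply/negP => hd.
have r0 : r != 0 by apply: contraTneq hd => ->.
have lon : logn 2 `|numq r| = 0%N.
  rewrite lognE /=; case: ifP => // /andP[_ hn].
  have := coprime_num_den r; rewrite /coprime => /eqP e.
  by have := dvdn_gcd 2 `|numq r| `|denq r|; rewrite e hn hd.
move: lt2; rewrite /abs2 (negbTE r0) lon expr0 divr1.
have := logn_gt0 2 `|denq r|; rewrite mem_primes hd absz_gt0 denq_eq0 /=.
case: (logn _ _) => // l _; rewrite exprS -[ltRHS]mulr1 ltr_pM2l //.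
by rewrite ltNge exprn_ege1.
Qed.

Lemma exists_pow2_ge (x : rat) : exists N : nat, x <= 2 ^+ N.
Proof.
have [h|h] := leP x 0; first by exists 0%N; apply: le_trans h _.
exists (Num.bound x); apply/ltW/(lt_le_trans (archi_boundP (ltW h))).
by rewrite -natrX ler_nat ltnW // ltn_expl.
Qed.

Variables (F : fieldExtType Q2) (A : idomainType) (iota : {rmorphism A -> F}).
Hypotheses (hA : is_ring_of_integers nrm iota) (hunr : is_unramified A).

Lemma iota_inj : injective iota.
Proof. by case: hA. Qed.

Lemma F_two_neq0 : 2 != 0 :> F.
Proof. by rewrite -(rmorph_nat (in_alg F)) fmorph_eq0 Q2_two_neq0. Qed.

Lemma A_two_neq0 : 2 != 0 :> A.
Proof.
apply: contraNneq F_two_neq0 => e.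
by rewrite -(rmorph_nat iota) e rmorph0.
Qed.

Lemma Z2_in_A (z : Q2) : nrm z <= 1 -> exists a, iota a = z%:A.
Proof.
move=> hz; suff /(proj2 hA)[a ->] : integral_over_Z2 nrm (z%:A : F) by exists a.
exists ('X - z%:P); split; first exact: monicXsubC.
  move=> j; rewrite coefB coefX coefC.
  case: j => [|[|j]] /=; rewrite ?sub0r ?subr0 ?nrmN ?nrm1 ?nrm0 //.
by rewrite rmorphB /= map_polyX map_polyC /= root_XsubC.
Qed.

Lemma integral_relation (a : A) : exists D (c : nat -> A),
  a ^+ D = - \sum_(j < D) c j * a ^+ j /\
  forall j, exists2 z : Q2, nrm z <= 1 & iota (c j) = z%:A.
Proof.
have /(proj2 hA)[p [pm pc pr]] : exists b, iota a = iota b by exists a.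
pose c j := proj1_sig (constructive_indefinite_description _ (Z2_in_A (pc j))).
have cE j : iota (c j) = (p`_j)%:A.
  by rewrite /c; case: constructive_indefinite_description.
exists (size p).-1, c; split; last by move=> j; exists p`_j.
apply: iota_inj; rewrite rmorphXn rmorphN rmorph_sum; apply/eqP.
rewrite -addr_eq0; move: pr; rewrite /root horner_coef size_map_poly.
have -> : size p = (size p).-1.+1.
  by rewrite prednK // lt0n size_poly_eq0 monic_neq0.
rewrite big_ord_recr /= addrC => pr.
suff -> : iota a ^+ (size p).-1 + \sum_(i < (size p).-1) iota (c i * a ^+ i) =
  (map_poly (in_alg F) p)`_(size p).-1 * iota a ^+ (size p).-1 +
  \sum_(i < (size p).-1) (map_poly (in_alg F) p)`_i * iota a ^+ i by [].
congr (_ + _).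
  by rewrite coef_map -lead_coefE (monicP pm) /= scale1r mul1r.
by apply: eq_bigr => j _; rewrite coef_map rmorphM rmorphXn cE.
Qed.

(** The constant term of an integral equation of [a] is a multiple of [a]. If it is zero, cancelling
    [a] lowers the degree; otherwise it is a nonzero element of Z_2 and divides a power of 2. *)
Lemma dvd_pow2 (a : A) : a != 0 -> exists N b, a * b = 2 ^+ N.
Proof.
move=> a0; have [D [c [hD hc]]] := integral_relation a.
elim: D c hD hc => [|D IH] c hD hc.
  by move: hD; rewrite big_ord0 expr0 oppr0 => /eqP; rewrite oner_eq0.
move: hD; rewrite big_ord_recl expr0 mulr1 => hD.
have [c0|c0] := eqVneq (c 0%N) 0.
  apply: (IH (c \o S)); last by move=> j; apply: hc.
  apply: (mulfI a0); rewrite -exprS hD c0 add0r mulrN mulr_sumr; congr (- _).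
  by apply: eq_bigr => j _; rewrite /= exprS mulrCA.
have [z hz zE] := hc 0%N.
have z0 : z != 0.
  apply: contraNneq c0 => z0; apply/eqP/iota_inj.
  by rewrite zE z0 scale0r rmorph0.
have [N hN] := exists_pow2_ge (nrm z^-1).
have [b bE] : exists b, iota b = (2 ^+ N / z)%:A.
  apply: Z2_in_A; rewrite (Q2_mul hQ2).
  have -> : nrm (2 ^+ N) = (2 ^+ N)^-1.
    elim: {hN} N => [|N IHN]; first by rewrite !expr0 invr1 nrm1.
    by rewrite !exprS (Q2_mul hQ2) IHN nrm_two invfM mul1r.
  by rewrite mulrC ler_pdivrMr ?exprn_gt0 // mul1r.
have cb : c 0%N * b = 2 ^+ N.
  apply: iota_inj; rewrite rmorphM zE bE -scalerAl mul1r scalerA mulrC divfK //.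
  by rewrite -[LHS]/(in_alg F _) !rmorphXn !rmorph_nat.
exists N, (- (a ^+ D + \sum_(i < D) c i.+1 * a ^+ i) * b).
rewrite -cb mulrA; congr (_ * _); rewrite mulrN mulrDr -exprS hD mulr_sumr.
rewrite opprD opprK -addrA -[RHS]addr0; congr (_ + _).
apply/eqP; rewrite subr_eq0; apply/eqP; apply: eq_bigr => j _.
by rewrite /= /bump /= add1n exprS mulrCA.
Qed.

(** A non-unit is divisible by 2, and each division uses up one factor of the power [2 ^+ N] that
    [a] divides, so the process stops. *)
Lemma pow2_unit (a : A) : a != 0 -> exists m b c, a = 2 ^+ m * b /\ b * c = 1.
Proof.
move=> a0; have [N [b ab]] := dvd_pow2 a0.
elim: N a a0 b ab => [|N IH] a a0 b ab.
  by exists 0%N, a, b; rewrite expr0 mul1r.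
have [/unitrPr[c ac]|] := boolP (a \is a GRing.unit).
  by exists 0%N, a, c; rewrite expr0 mul1r.
move/hunr => [a' aE]; move: a0 ab; rewrite aE => a0 ab.
have a'0 : a' != 0 by apply: contraNneq a0 => ->; rewrite mulr0.
have [|m [c [e [-> ce]]]] := IH a' a'0 b.
  by apply: (mulfI A_two_neq0); rewrite mulrA ab exprS.
by exists m.+1, c, e; rewrite exprS mulrA.
Qed.

Lemma dvd_total (a b : A) : (exists c, a = c * b) \/ (exists c, b = c * a).
Proof.
have [->|a0] := eqVneq a 0; first by left; exists 0; rewrite mul0r.
have [->|b0] := eqVneq b 0; first by right; exists 0; rewrite mul0r.
have [m [u [u' [-> uu]]]] := pow2_unit a0.
have [l [v [v' [-> vv]]]] := pow2_unit b0.
case: (leqP m l) => h; [right|left].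
  exists (2 ^+ (l - m) * v * u'); rewrite -{1}(subnK h) exprD.
  by rewrite -[LHS]mulr1 -uu; ring.
exists (2 ^+ (m - l) * u * v'); rewrite -{1}(subnK (ltnW h)) exprD.
by rewrite -[LHS]mulr1 -vv; ring.
Qed.

Lemma exists_common_divisor m (a : 'rV[A]_m.+1) :
  exists (j : 'I_m.+1) (c : 'rV[A]_m.+1), a = a 0 j *: c.
Proof.
suff [j hj] : exists j, forall l, exists c, a 0 l = a 0 j * c.
  exists j, (\row_l proj1_sig (constructive_indefinite_description _ (hj l))).
  apply/rowP => l; rewrite !mxE.
  by case: constructive_indefinite_description.
elim: m a => [|m IH] a.
  by exists ord0 => l; exists 1; rewrite mulr1 (ord1 l).
have [j hj] := IH (\row_l a 0 (lift ord0 l)).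
have [[c e]|[c e]] := dvd_total (a 0 ord0) (a 0 (lift ord0 j)).
  exists (lift ord0 j) => l; case: (unliftP ord0 l) => [l' ->|->].
    by have [c' e'] := hj l'; exists c'; rewrite !mxE in e'.
  by exists c; rewrite e mulrC.
exists ord0 => l; case: (unliftP ord0 l) => [l' ->|->].
  have [c' e'] := hj l'; exists (c * c'); rewrite !mxE in e'.
  by rewrite e' e; ring.
by exists 1; rewrite mulr1.
Qed.

(** One coefficient [a 0 j] of the relation divides all of them, say [a = a 0 j *: c].
    Torsion-freeness gives [c x = 0], so [x] is fixed by [1 - e_j c], a matrix killed by [a]. *)
Lemma torsion_free_flat (R : comNzRingType) (u : {rmorphism A -> R}) :
  (forall a y, a != 0 -> u a * y = 0 -> y = 0) -> flat u.
Proof.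
move=> tf [|m] a x ax.
  by exists 0%N, 0, 0; rewrite !mulmx0; split=> //; apply/matrixP => -[].
have [j [c aE]] := exists_common_divisor a.
have [a0|a0] := eqVneq (a 0 j) 0.
  exists m.+1, 1%:M, x; rewrite map_mx1 mul1mx aE a0 scale0r mul0mx.
  by [].
exists m.+1, (1%:M - delta_mx j 0 *m c), x; split; last first.
  rewrite mulmxBr mulmx1 mulmxA -colE {1}aE.
  have -> : col j a = (a 0 j)%:M by apply/matrixP => i l; rewrite !ord1 !mxE eqxx.
  by rewrite mul_scalar_mx subrr.
rewrite map_mxB map_mx1 map_mxM mulmxBl mul1mx -mulmxA.
suff -> : map_mx u c *m x = 0 by rewrite mulmx0 subr0.
apply/matrixP => i l; rewrite !ord1 [RHS]mxE; apply: (tf _ _ a0).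
have uaE : map_mx u a = u (a 0 j) *: map_mx u c by rewrite -map_mxZ -aE.
by have /matrixP/(_ 0 0) := ax; rewrite uaE -scalemxAl ![in LHS]mxE [in RHS]mxE mxE.
Qed.

Variables (k : fieldType) (pi : {rmorphism A -> k}) (hk : is_quotient_mod2 pi).

Lemma residue_two : 2 = 0 :> k.
Proof.
by rewrite -(rmorph_nat pi); apply/(proj2 hk); exists 1; rewrite mulr1.
Qed.

Lemma residue_addrr (x : k) : x + x = 0.
Proof. by rewrite -mulr2n -mulr_natr residue_two mulr0. Qed.

Lemma residue_nat (l : nat) : l%:R = (odd l)%:R :> k.
Proof.
rewrite -[in LHS](odd_double_half l) natrD -muln2 natrM residue_two mulr0.
by rewrite addr0.
Qed.

(** A rational [r] within 1/2 of [z] has odd denominator and differs from [z] by an element of 2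
    Z_2, so the residue of [a] is the parity of the numerator. *)
Lemma residue_Z2 (a : A) (z : Q2) : nrm z <= 1 -> iota a = z%:A ->
  exists b : bool, pi a = b%:R.
Proof.
move=> hz aE; have [r hr] := Q2_dense hQ2 z (isT : 0 < 1 / 2 :> rat).
have r2 : abs2 r < 2.
  rewrite -nrm_rat; have -> : ratr r = z + - (z - ratr r) by rewrite opprB addrC subrK.
  apply: le_lt_trans (Q2_add hQ2 _ _) _; rewrite nrmN.
  by apply: le_lt_trans (lerD hz (ltW hr)) _.
have [c cE] : exists c, iota c = ((z - ratr r) / 2)%:A.
  apply: Z2_in_A; rewrite (Q2_mul hQ2).
  have -> : nrm 2^-1 = 2.
    by have := Q2_mul hQ2 2 2^-1; rewrite divff ?Q2_two_neq0 // nrm1 nrm_two;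
      move=> e; apply: (@mulfI _ (1 / 2)) => //; rewrite -e.
  by rewrite -ler_pdivlMr // ltW.
have e : (denq r)%:~R * (a - 2 * c) = (numq r)%:~R :> A.
  have h : (denq r)%:~R * (z - 2 * ((z - ratr r) / 2)) = (numq r)%:~R :> Q2.
    rewrite [2 * _]mulrC divfK ?Q2_two_neq0 // opprB addrC subrK /ratr mulrC.
    by rewrite divfK // Q2_int_neq0 ?denq_eq0.
  apply: iota_inj; rewrite rmorphM rmorphB rmorphM !rmorph_int rmorph_nat aE cE.
  have := congr1 (in_alg F) h.
  by rewrite rmorphM rmorphB rmorphM !rmorph_int rmorph_nat.
have {e} := congr1 pi e; rewrite rmorphM rmorphB rmorphM !rmorph_int rmorph_nat.
rewrite residue_two mul0r subr0 -absz_denq -[X in X%:~R * _]/(Posz _) -pmulrn.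
rewrite residue_nat; have -> : odd `|denq r| by rewrite -[odd _]negbK -dvdn2 abs2_lt2.
rewrite mul1r => ->; case: (intP (numq r)) => [|l|l].
- by exists false.
- by exists (odd l.+1); rewrite -residue_nat.
- exists (odd l.+1); rewrite rmorphN -residue_nat; apply/eqP.
  by rewrite eq_sym -subr_eq0 opprK residue_addrr.
Qed.

(** All powers of [z] lie in the finite set of F_2-combinations of its first [D] powers, so
    [z ^+ r = 1] for some positive [r]. Squaring is injective, hence [r] may be taken odd, and then
    [z] is the square of [z ^+ ((r + 1) / 2)]. *)
Lemma residue_perfect (z : k) : exists y, y ^+ 2 = z.
Proof.
have [->|z0] := eqVneq z 0; first by exists 0; rewrite expr0n.
have [a aE] := proj1 hk z.
have [D [c [hD hc]]] := integral_relation a.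
have {hc} hb j : exists b : bool, pi (c j) = b%:R.
  by have [x hx xE] := hc j; apply: residue_Z2 hx xE.
have zD : z ^+ D = \sum_(j < D) pi (c j) * z ^+ j.
  rewrite aE -rmorphXn hD rmorphN rmorph_sum; apply/eqP.
  rewrite -subr_eq0 -opprD oppr_eq0; apply/eqP.
  under [X in _ + X]eq_bigr => j _ do rewrite -rmorphXn -rmorphM.
  exact: residue_addrr.
have hpow (l : nat) : exists e : {ffun 'I_D -> bool}, z ^+ l = \sum_j (e j)%:R * z ^+ j.
  elim: l => [|l [e IH]].
    case: D zD {hD} => [|D] zD.
      move: zD; rewrite big_ord0 expr0 => /eqP; by rewrite oner_eq0.
    exists [ffun j => j == ord0]; rewrite (bigD1 ord0) //= ffunE eqxx mul1r.
    by rewrite big1 ?addr0 // => j /negbTE j0; rewrite ffunE j0 mul0r.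
  case: D zD {hD} e IH => [|D] zD e IH.
    by exists e; rewrite big_ord0 exprS IH big_ord0 mulr0.
  have [f hf] := fin_all_exists (fun j : 'I_D.+1 => hb j).
  (* Multiplication by [z] shifts the coefficients and re-expands the overflow [z ^+ D.+1] by its
     relation; exclusive or is addition in characteristic 2. *)
  exists [ffun j =>
    (if unlift ord0 j is Some i then e (widen_ord (leqnSn D) i) else false)
    (+) (e ord_max && f j)].
  have bxor (b1 b2 : bool) : (b1 (+) b2)%:R = b1%:R + b2%:R :> k.
    by case: b1 b2 => [] []; rewrite /= ?addr0 ?add0r ?residue_addrr.
  have -> : z ^+ l.+1 = \sum_(j < D.+1)
      ((if unlift ord0 j is Some i then e (widen_ord (leqnSn D) i) else false)%:R
       + (e ord_max)%:R * (f j)%:R) * z ^+ j.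
    under eq_bigr => j _ do rewrite mulrDl -mulrA.
    rewrite big_split /= -mulr_sumr.
    under [X in _ * X]eq_bigr => j _ do rewrite -hf.
    rewrite -zD exprS IH big_ord_recr /= mulrDr mulrCA -exprS; congr (_ + _).
    rewrite big_ord_recl unlift_none mul0r add0r mulr_sumr.
    by apply: eq_bigr => j _; rewrite liftK /= /bump /= add1n exprS mulrCA.
  by apply: eq_bigr => j _; rewrite ffunE bxor -mulnb natrM; case: unlift.
have [e he] := fin_all_exists (fun l : 'I_(#|{: {ffun 'I_D -> bool}}|.+1) => hpow l).
have [l1 [l2 [lt12 e12]]] :
    exists l1 l2 : 'I_(#|{: {ffun 'I_D -> bool}}|.+1), (l1 < l2)%N /\ e l1 = e l2.
  have /injectivePn[l1 [l2 ne e12]] : ~~ injectiveb e.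
    apply/negP => /injectiveP/leq_card; rewrite card_ord ltnn //.
  move: ne; rewrite -val_eqE neq_ltn => /orP[] h; [exists l1, l2|exists l2, l1] => //.
have {hpow he e e12 hD zD hb aE} [r r0 zr] : exists2 r, (0 < r)%N & z ^+ r = 1.
  exists (l2 - l1)%N; first by rewrite subn_gt0.
  have h : z ^+ l1 = z ^+ l2 by rewrite !he e12.
  apply: (mulIf (expf_neq0 l1 z0)); rewrite -exprD subnK 1?ltnW // mul1r h //.
have frob (x : k) : x ^+ 2 = 1 -> x = 1.
  move=> x2; apply/eqP; rewrite -subr_eq0 -sqrf_eq0 sqrrB x2 expr1n mulr1.
  by rewrite -mulr_natr residue_two mulr0 subr0 residue_addrr.
elim/ltn_ind: r r0 zr => r IH r0 zr; case ro: (odd r).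
  exists (z ^+ r./2.+1); rewrite -exprM.
  have -> : (r./2.+1 * 2 = r.+1)%N.
    by rewrite muln2 doubleS -[in RHS](odd_double_half r) ro add1n.
  by rewrite exprS zr mulr1.
have rE : r = (r./2 * 2)%N by rewrite muln2 -[LHS](odd_double_half r) ro.
apply: (IH r./2).
- by rewrite [ltnRHS]rE ltn_Pmulr // lt0n; apply: contraTneq r0 => h; rewrite rE h.
- by rewrite lt0n; apply: contraTneq r0 => h; rewrite rE h.
- by apply: frob; rewrite -exprM -rE.
Qed.

End Dyadic.

(** * Quadratic forms in coordinates and their extension of scalars *)

Lemma sum_split_diag (V : nmodType) d (f : 'I_d -> 'I_d -> V) :
  \sum_j \sum_l f j l =
  \sum_j f j j + \sum_(j < d) \sum_(l < d | (j < l)%N) (f j l + f l j).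
Proof.
under [X in _ = _ + X]eq_bigr => j _ do rewrite big_split.
rewrite big_split [X in _ = _ + (_ + X)](exchange_big_dep predT) //= -!big_split.
apply: eq_bigr => j _ /=; rewrite (bigD1 j) //=; congr (_ + _).
rewrite (bigID (fun l : 'I_d => (j < l)%N)) /=; congr (_ + _); apply: eq_bigl => l.
  by rewrite -val_eqE /=; case: ltngtP.
by rewrite -val_eqE /=; case: ltngtP.
Qed.

(** The values [D] on the basis are kept apart from the polar matrix [h], whose diagonal [2 * D]
    forgets them in characteristic 2. *)
Definition quad (R : comNzRingType) d (D : 'I_d -> R) (h : 'M[R]_d)
    (x : 'cV[R]_d) : R :=
  \sum_j D j * x j 0 ^+ 2 + \sum_(j < d) \sum_(l < d | (j < l)%N) h j l * x j 0 * x l 0.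

Lemma bilin_sum (R : comNzRingType) d (h : 'M[R]_d) (x y : 'cV[R]_d) :
  bilin h x y = \sum_j \sum_l x j 0 * h j l * y l 0.
Proof.
rewrite /bilin mxE exchange_big /=; apply: eq_bigr => l _.
by rewrite !mxE mulr_suml; apply: eq_bigr => j _; rewrite mxE.
Qed.

Lemma bilin_map (R S : comNzRingType) (f : {rmorphism R -> S}) d (h : 'M[R]_d) x y :
  f (bilin h x y) = bilin (map_mx f h) (map_mx f x) (map_mx f y).
Proof. by rewrite /bilin map_trmx -!map_mxM [RHS]mxE. Qed.

Lemma quad_map (R S : comNzRingType) (f : {rmorphism R -> S}) d
    (D : 'I_d -> R) h x :
  f (quad D h x) = quad (f \o D) (map_mx f h) (map_mx f x).
Proof.
rewrite /quad rmorphD !rmorph_sum; congr (_ + _); apply: eq_bigr => j _.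
  by rewrite rmorphM rmorphXn mxE.
by rewrite rmorph_sum; apply: eq_bigr => l _; rewrite !rmorphM !mxE.
Qed.

Lemma eq_quad (R : comNzRingType) d (D D' : 'I_d -> R) (h h' : 'M[R]_d) x :
  D =1 D' -> h = h' -> quad D h x = quad D' h' x.
Proof.
by move=> e ->; congr (_ + _); apply: eq_bigr => j _; rewrite e.
Qed.

Section Quad.

Variables (R : comNzRingType) (d : nat) (D : 'I_d -> R) (h : 'M[R]_d).
Hypothesis h_sym : h^T = h.
Hypothesis h_diag : forall j, h j j = 2 * D j.

Let hC j l : h l j = h j l.
Proof. by rewrite -{1}h_sym mxE. Qed.

Lemma quadD x y : quad D h (x + y) = quad D h x + quad D h y + bilin h x y.
Proof.
rewrite bilin_sum sum_split_diag /quad -!big_split /=; apply: eq_bigr => j _.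
have -> : \sum_(l < d | (j < l)%N) h j l * (x + y) j 0 * (x + y) l 0 =
    \sum_(l < d | (j < l)%N) h j l * x j 0 * x l 0 +
    \sum_(l < d | (j < l)%N) h j l * y j 0 * y l 0 +
    \sum_(l < d | (j < l)%N) (x j 0 * h j l * y l 0 + x l 0 * h l j * y j 0).
  rewrite -!big_split /=; apply: eq_bigr => l _.
  by rewrite !mxE hC; ring.
by rewrite mxE h_diag; ring.
Qed.

Lemma quadZ a x : quad D h (a *: x) = a ^+ 2 * quad D h x.
Proof.
rewrite /quad mulrDr !mulr_sumr; congr (_ + _); apply: eq_bigr => j _.
  by rewrite mxE; ring.
by rewrite mulr_sumr; apply: eq_bigr => l _; rewrite !mxE; ring.
Qed.

Lemma bilin_diag x : bilin h x x = 2 * quad D h x.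
Proof.
rewrite bilin_sum sum_split_diag /quad mulrDr !mulr_sumr; congr (_ + _).
  by apply: eq_bigr => j _; rewrite h_diag; ring.
apply: eq_bigr => j _; rewrite mulr_sumr; apply: eq_bigr => l _.
by rewrite hC; ring.
Qed.

Lemma quad_delta j : quad D h (delta_mx j 0) = D j.
Proof.
rewrite /quad (bigD1 j) //= !mxE !eqxx expr1n mulr1 big1 ?addr0; last first.
  by move=> l /negbTE ne; rewrite !mxE ne expr0n mulr0.
rewrite big1 ?addr0 // => i _; rewrite big1 // => l il.
have [ij|ne] := eqVneq i j; last by rewrite !mxE (negbTE ne) mulr0 mul0r.
by rewrite !mxE -ij [l == i](gtn_eqF il) mulr0.
Qed.

End Quad.

Lemma bilin_delta (R : comNzRingType) d (h : 'M[R]_d) j l :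
  bilin h (delta_mx j 0) (delta_mx l 0) = h j l.
Proof. by rewrite /bilin trmx_delta -rowE -colE !mxE. Qed.

Lemma bilin_eq0 (R : comNzRingType) d (h : 'M[R]_d) x :
  (forall y, bilin h x y = 0) -> x^T *m h = 0.
Proof.
move=> e; apply/matrixP => i j; rewrite ord1.
by have := e (delta_mx j 0); rewrite /bilin -colE mxE => ->; rewrite mxE.
Qed.

Definition nonsingular (R : comNzRingType) d (D : 'I_d -> R) (h : 'M[R]_d) :=
  forall x, (forall y, bilin h x y = 0) -> quad D h x = 0 -> x = 0.

(* Over a perfect field the radical of the polar form has dimension at most 1,
   since the quadratic form is semilinear and anisotropic there; a line stays
   anisotropic after extension of scalars. *)
Lemma nonsingular_ext (k K : fieldType) (w : {rmorphism k -> K}) d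
    (D : 'I_d -> k) (h : 'M[k]_d) :
  h^T = h -> (forall j, h j j = 2 * D j) -> 2 = 0 :> k ->
  (forall z : k, exists y, y ^+ 2 = z) ->
  nonsingular D h -> nonsingular (w \o D) (map_mx w h).
Proof.
move=> hs hd char2 perfect ns x /bilin_eq0 xh Qx.
have rad (r : 'rV_d) : (r <= kermx h)%MS -> forall y, bilin h r^T y = 0.
  by move=> /sub_kermxP rh y; rewrite /bilin trmxK rh mul0mx mxE.
have [y xE] : exists y, x^T = y *m map_mx w (kermx h).
  by apply/submxP; rewrite map_kermx; apply/sub_kermxP.
have [k0|] := boolP (kermx h == 0).
  apply: trmx_inj; rewrite xE (eqP k0).
  by apply/matrixP => i j; rewrite map_mx0 mulmx0 !mxE.
case/rowV0Pn => r rk r0.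
have Qr : quad D h r^T != 0.
  apply: contraNneq r0 => Qr; rewrite -[r]trmxK (ns _ (rad _ rk) Qr).
  by rewrite trmx0.
have lineP (s : 'rV_d) : (s <= kermx h)%MS -> exists a, s = a *: r.
  move=> sk; have [a aE] := perfect (quad D h s^T / quad D h r^T).
  exists a; apply/eqP; rewrite -subr_eq0; apply/eqP; apply: trmx_inj.
  rewrite trmx0; apply: ns.
    by apply: rad; rewrite addmx_sub // eqmx_opp scalemx_sub.
  rewrite linearB linearZ /= quadD // -scaleNr quadZ // sqrrN aE divfK //.
  rewrite rad // addr0 -mulr2n -mulr_natr char2 mulr0 //.
have {xE} [b xE] : exists b, x = b *: map_mx w r^T.
  have [c cE] := fin_all_exists (fun i => lineP _ (row_sub i (kermx h))).
  exists (\sum_i y 0 i * w (c i)); apply: trmx_inj; rewrite xE.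
  apply/rowP => j; rewrite !mxE mulr_suml; apply: eq_bigr => i _.
  have := congr1 (fun r : 'rV_d => r 0 j) (cE i); rewrite !mxE => ->.
  by rewrite rmorphM mulrA.
move: Qx; rewrite xE quadZ -quad_map => /eqP.
rewrite mulf_eq0 fmorph_eq0 (negbTE Qr) orbF sqrf_eq0 => /eqP ->.
by rewrite scale0r.
Qed.

(** * Base change of lattices and R-combinations of operators defined over A *)

Section BaseChangeTheory.

Variables (F : fieldType) (A : idomainType) (iota : {rmorphism A -> F}) (n : nat).
Variables (R : comNzRingType) (u : {rmorphism A -> R}).
Implicit Types (M : lattice F n) (x : 'cV[R]_n) (y : 'cV[A]_n).
Local Notation bc := (base_change iota u).

Lemma base_change0 N M : bc N M 0.
Proof. by exists 0%N, (fun=> 0), (fun=> 0); split=> [[]//|]; rewrite big_ord0. Qed.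

Lemma base_changeD N M x x' : bc N M x -> bc N M x' -> bc N M (x + x').
Proof.
move=> [p [r [y [hy ->]]]] [p' [r' [y' [hy' ->]]]].
exists (p + p')%N.
exists (fun t => match split t with inl s => r s | inr s => r' s end).
exists (fun t => match split t with inl s => y s | inr s => y' s end).
split=> [t|]; first by case: (split t).
rewrite big_split_ord; congr (_ + _); apply: eq_bigr => t _.
  by rewrite -[lshift _ t]/(unsplit (inl t)) unsplitK.
by rewrite -[rshift _ t]/(unsplit (inr t)) unsplitK.
Qed.

Lemma base_change_gen N M (r : R) y v :
  M v -> map_mx iota y = 2 ^+ N *: v -> bc N M (r *: map_mx u y).
Proof.
move=> Mv yv; exists 1%N, (fun=> r), (fun=> y); split=> [t|].
  by exists v.
by rewrite big_ord1.
Qed.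

Lemma base_change_ind N M (P : 'cV[R]_n -> Prop) :
  P 0 -> (forall x x', P x -> P x' -> P (x + x')) ->
  (forall r y v, M v -> map_mx iota y = 2 ^+ N *: v -> P (r *: map_mx u y)) ->
  forall x, bc N M x -> P x.
Proof.
move=> P0 PD Pg x [p [r [y [hy ->]]]].
by apply: (big_ind P) => // t _; have [v Mv e] := hy t; apply: Pg e.
Qed.

Lemma base_changeZ N M (a : R) x : bc N M x -> bc N M (a *: x).
Proof.
move=> [p [r [y [hy ->]]]]; exists p, (fun t => a * r t), y; split=> //.
by rewrite scaler_sumr; apply: eq_bigr => t _; rewrite scalerA.
Qed.

Lemma base_change_sum N M (I : Type) (s : seq I) (P : pred I) (f : I -> 'cV[R]_n) :
  (forall i, P i -> bc N M (f i)) -> bc N M (\sum_(i <- s | P i) f i).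
Proof.
move=> h; apply: (big_ind (bc N M)) => //; first exact: base_change0.
by move=> x x'; apply: base_changeD.
Qed.

Lemma base_change_mulmx N M d (Y : 'M[R]_(n, d)) (c : 'cV[R]_d) :
  (forall t, bc N M (col t Y)) -> bc N M (Y *m c).
Proof.
move=> h; have -> : Y *m c = \sum_t c t 0 *: col t Y.
  apply/matrixP => i j; rewrite ord1 mxE summxE; apply: eq_bigr => t _.
  by rewrite !mxE mulrC.
by apply: base_change_sum => t _; apply: base_changeZ.
Qed.

Lemma base_change_map (R' : comNzRingType) (u' : {rmorphism A -> R'})
    (f : {rmorphism R -> R'}) N M x :
  f \o u =1 u' -> bc N M x -> base_change iota u' N M (map_mx f x).
Proof.
move=> fu [p [r [y [hy ->]]]]; exists p, (f \o r), y; split=> //.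
rewrite map_mx_sum; apply: eq_bigr => t _; rewrite map_mxZ; congr (_ *: _).
by apply/matrixP => i j; rewrite !mxE; apply: fu.
Qed.

Inductive mspan (E : 'M[A]_n -> Prop) : 'M[R]_n -> Prop :=
| mspan0 : mspan E 0
| mspan_cons r T h : E T -> mspan E h -> mspan E (r *: map_mx u T + h).

Lemma mspanD E h h' : mspan E h -> mspan E h' -> mspan E (h + h').
Proof.
elim=> [|r T g ET _ IH] hh'; first by rewrite add0r.
by rewrite -addrA; apply: mspan_cons => //; apply: IH.
Qed.

Lemma mspanZ E a h : mspan E h -> mspan E (a *: h).
Proof.
elim=> [|r T g ET _ IH]; first by rewrite scaler0; apply: mspan0.
by rewrite scalerDr scalerA; apply: mspan_cons.
Qed.

Lemma mspan_sum E (I : Type) (s : seq I) (P : pred I) (f : I -> 'M[R]_n) :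
  (forall i, P i -> mspan E (f i)) -> mspan E (\sum_(i <- s | P i) f i).
Proof.
move=> h; apply: (big_ind (mspan E)) => //; first exact: mspan0.
by move=> x x'; apply: mspanD.
Qed.

Lemma mspanW E E' h : (forall T, E T -> E' T) -> mspan E h -> mspan E' h.
Proof.
move=> sub; elim=> [|r T g ET _ IH]; first exact: mspan0.
by apply: mspan_cons => //; apply: sub.
Qed.

Lemma mspanM E h h' : (forall T T', E T -> E T' -> E (T *m T')) ->
  mspan E h -> mspan E h' -> mspan E (h *m h').
Proof.
move=> EM; elim=> [|r T g ET _ IH] hh'; first by rewrite mul0mx; apply: mspan0.
rewrite mulmxDl; apply: mspanD; last exact: IH.
rewrite -scalemxAl; apply: mspanZ.
elim: hh' => [|r' T' g' ET' _ IH']; first by rewrite mulmx0; apply: mspan0.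
rewrite mulmxDr -scalemxAr -map_mxM; apply: mspan_cons => //.
exact: EM.
Qed.

(** Operators commute with scaling by [2 ^+ N], so one condition on lattices in V over A settles
    every [N] occurring in [maps_to]. *)
Lemma mspan_maps E M M' h :
  (forall T, E T -> forall v, M v -> M' (map_mx iota T *m v)) ->
  mspan E h -> forall N x, bc N M x -> bc N M' (h *m x).
Proof.
move=> EM hh N x Mx; elim: hh => [|r T g ET _ IH].
  by rewrite mul0mx; apply: base_change0.
rewrite mulmxDl; apply: base_changeD => //; rewrite -scalemxAl.
apply: base_changeZ; elim/base_change_ind: x / Mx {IH} => [|x x' hx hx'|a y v Mv e].
- by rewrite mulmx0; apply: base_change0.
- by rewrite mulmxDr; apply: base_changeD.
- rewrite -scalemxAr -map_mxM; apply: (base_change_gen _ (EM _ ET _ Mv)).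
  by rewrite map_mxM e -scalemxAr.
Qed.

Lemma mspan_maps1 E M m :
  (forall T, E T -> forall v, M v -> M (map_mx iota T *m v)) ->
  mspan E (m - 1%:M) -> forall N x, bc N M x -> bc N M (m *m x).
Proof.
move=> EM hm N x Mx; have -> : m *m x = (m - 1%:M) *m x + x.
  by rewrite mulmxBl mul1mx subrK.
by apply: base_changeD => //; apply: (mspan_maps EM hm).
Qed.

End BaseChangeTheory.

(** * Operators x |-> b_i(v,x) v' and the conditions defining M *)

Section LatticeTheory.

Variables (F : fieldType) (A : idomainType) (iota : {rmorphism A -> F}).
Hypotheses (two_F : 2 != 0 :> F).
Hypothesis two_prime : forall a b : A, a ^+ 2 = 2 * b -> exists c, a = 2 * c.
Hypothesis iota_inj : injective iota.
Variables (n : nat) (q : 'cV[A]_n -> A) (G : 'M[A]_n).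
Hypothesis G_sym : G^T = G.
Hypothesis qVE : forall x, qV iota q x = bilin (map_mx iota G) x x.

Local Notation bV := (bV iota q).
Local Notation qV := (qV iota q).
Local Notation Llat := (@Llat F A iota n).
Local Notation latA := (latA iota q).
Local Notation latB := (latB iota q).
Local Notation latW := (latW iota q).
Local Notation latX := (latX iota q).
Local Notation latY := (latY iota q).
Local Notation latZ := (latZ iota q).
Local Notation dual := (dual iota q).

Let pow2 i : 2 ^+ i != 0 :> F.
Proof. exact: expf_neq0. Qed.

Let GF_sym : (map_mx iota G)^T = map_mx iota G.
Proof. by rewrite map_trmx G_sym. Qed.

Lemma bVE x y : bV x y = bilin (map_mx iota G) x y.
Proof.
rewrite /Defs.bV !qVE !bilinE [bilin _ y x]bilin_sym //.
set a := bilin _ x x; set b := bilin _ y y; set c := bilin _ x y.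
by apply: (mulIf two_F); rewrite divfK //; ring.
Qed.

Lemma bVC x y : bV x y = bV y x.
Proof. by rewrite !bVE bilin_sym. Qed.

Lemma inA_biP i x y :
  inA iota (bi iota q i x y) <-> exists a, bV x y = 2 ^+ i * iota a.
Proof.
rewrite /inA /bi; split=> -[a e]; exists a; first by rewrite -e mulrC divfK.
by rewrite e mulrC mulKf.
Qed.

Lemma congr_biP i x y :
  Defs.congr2 iota (bi iota q i x y) 0 <-> exists a, bV x y = 2 ^+ i.+1 * iota a.
Proof.
rewrite /Defs.congr2 /bi subr0 exprS; split=> -[a e]; exists a.
  by rewrite [2 * _]mulrC -mulrA -e mulrC divfK.
by rewrite e mulrAC mulfK.
Qed.

Lemma congr_qiP i x :
  Defs.congr2 iota (qi iota q i x) 0 <-> exists a, qV x = 2 ^+ i.+1 * iota a.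
Proof.
rewrite /Defs.congr2 /qi subr0 exprS; split=> -[a e]; exists a.
  by rewrite [2 * _]mulrC -mulrA -e mulrC divfK.
by rewrite e mulrAC mulfK.
Qed.

Lemma LlatZ a x : Llat x -> Llat (iota a *: x).
Proof. by case=> y ->; exists (a *: y); rewrite map_mxZ. Qed.

Lemma latAP i x :
  latA i x <-> Llat x /\ forall y, Llat y -> exists a, bV x y = 2 ^+ i * iota a.
Proof. by split=> -[Lx h]; split=> // y /h /inA_biP. Qed.

Lemma latBP i x :
  latB i x <-> latA i x /\ exists a, qV x = 2 ^+ i.+1 * iota a.
Proof. by split=> -[Lx h]; split=> //; apply/congr_qiP. Qed.

Lemma latXZ_intro j x c : latA j x ->
  (forall y, latA j y -> exists a, bV x y = 2 ^+ j.+1 * iota a) ->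
  qV x = 2 ^+ j.+2 * iota c -> capl (latX j) (latZ j) x.
Proof.
move=> Ax hb hq; split; first by split=> // y /hb /congr_biP.
split; last by apply/congr_qiP; exists c.
split; last by move=> y [Ay _]; apply/congr_biP/hb.
by apply/latBP; split=> //; exists (2 * c); rewrite hq exprS rmorphM rmorph_nat; ring.
Qed.

Lemma latB_scale i a x : latB i x -> latB i (iota a *: x).
Proof.
move=> /latBP[/latAP[Lx hx] [c qx]]; apply/latBP; split.
  apply/latAP; split; first exact: LlatZ.
  move=> y /hx[b e]; exists (a * b); rewrite bVE bilinE -bVE e rmorphM; ring.
exists (a ^+ 2 * c); rewrite qVE !bilinE -qVE qx rmorphM rmorphXn; ring.
Qed.

(** For [j < i] the vector [v'] itself pairs with L into 2^i A and has q in 2^(i+1) A, enough at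
    level [j]. For [j > i] the coefficient b_i(v,x) is divisible by 2^(j-i), and for [j = i] it is
    assumed even; q then gains the square of this factor. *)
Lemma latB_XZ i j v' v x : latB i v -> latB i v' -> latA j x ->
  (j = i -> exists a, bV v x = 2 ^+ i.+1 * iota a) ->
  capl (latX j) (latZ j) ((bV v x / 2 ^+ i) *: v').
Proof.
move=> /latBP[/latAP[Lv hv] _] /latBP[/latAP[Lv' hv'] [c qv']] /latAP[Lx hx] hij.
case: (ltngtP j i) => h.
- have [a e] := hv _ Lx; rewrite e mulrC mulKf //.
  have iE : i = (j.+1 + (i - j.+1))%N by rewrite subnKC.
  apply: (@latXZ_intro _ _ (2 ^+ (i - j.+1) * a ^+ 2 * c)).
  + apply/latAP; split; first exact: LlatZ.
    move=> y /hv'[b e']; exists (2 ^+ (i - j.+1).+1 * a * b).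
    rewrite bVE bilinE -bVE e' {1}iE.
    by rewrite exprD !rmorphM rmorphXn rmorph_nat !exprS; ring.
  + move=> y /latAP[/hv'[b e'] _]; exists (2 ^+ (i - j.+1) * a * b).
    rewrite bVE bilinE -bVE e' {1}iE.
    by rewrite exprD !rmorphM rmorphXn rmorph_nat; ring.
  + rewrite qVE !bilinE -qVE qv' {1}iE !exprS exprD !rmorphM !rmorphXn rmorph_nat.
    by ring.
- have [a e] := hx _ Lv; rewrite bVC e.
  have jE : j = (i + (j - i.+1).+1)%N by rewrite addnS -addSn subnKC.
  have -> : 2 ^+ j * iota a / 2 ^+ i = 2 ^+ (j - i.+1).+1 * iota a.
    by rewrite {1}jE exprD mulrAC [2 ^+ i * _]mulrC mulfK.
  rewrite -(rmorph_nat iota) -rmorphXn -rmorphM.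
  apply: (@latXZ_intro _ _ (2 ^+ (j - i.+1) * a ^+ 2 * c)).
  + apply/latAP; split; first exact: LlatZ.
    move=> y /hv'[b e']; exists (a * b); rewrite bVE bilinE -bVE e' {2}jE.
    by rewrite exprD !rmorphM !rmorphXn rmorph_nat; ring.
  + move=> y /latAP[_ /(_ _ Lv')[b e']]; exists (2 ^+ (j - i.+1) * a * b).
    rewrite bVE bilinE -bVE bVC e' !exprS.
    by rewrite !rmorphM !rmorphXn rmorph_nat; ring.
  + rewrite qVE !bilinE -qVE qv' {3}jE !exprS exprD !exprS !rmorphM !rmorphXn rmorph_nat.
    by ring.
- have [a e] := hij h; rewrite h e exprS.
  have -> : 2 * 2 ^+ i * iota a / 2 ^+ i = iota (2 * a).
    by rewrite rmorphM rmorph_nat mulrAC mulfK.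
  apply: (@latXZ_intro _ _ (2 * a ^+ 2 * c)).
  + apply/latAP; split; first exact: LlatZ.
    move=> y /hv'[b e']; exists (2 * a * b); rewrite bVE bilinE -bVE e'.
    by rewrite !rmorphM rmorph_nat; ring.
  + move=> y /latAP[/hv'[b e'] _]; exists (a * b); rewrite bVE bilinE -bVE e'.
    by rewrite !rmorphM rmorph_nat exprS; ring.
  + rewrite qVE !bilinE -qVE qv' !exprS !rmorphM rmorph_nat.
    by ring.
Qed.

Lemma latB_A_B i v v' x : latB i v -> latB i v' -> latA i x ->
  latB i ((bV v x / 2 ^+ i) *: v').
Proof.
move=> /latBP[/latAP[_ hv] _] Bv' [Lx _].
by have [a ->] := hv _ Lx; rewrite mulrC mulKf //; apply: latB_scale.
Qed.

(* On W_i the functional b_i(v,-) is a multiple of b_i(v,e), whose square is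
   2^(-i) q(v), which vanishes modulo 2 for v in B_i. *)
Lemma latB_latW i v x : latB i v -> latW i x -> exists a, bV v x = 2 ^+ i.+1 * iota a.
Proof.
move=> Bv [Ax [e [a [[Ae he] [Axe hx]]]]].
have [Av qv] : latA i v /\ exists c, qV v = 2 ^+ i.+1 * iota c by apply/latBP.
have [c bve] : exists a, bV v e = 2 ^+ i * iota a.
  by have /latAP[_ /(_ _ (proj1 Ae))] := Av.
have [c' cE] : exists c', c = 2 * c'.
  have [c'' qvE] := qv; have [b] := he _ Av.
  have e1 : 2 ^+ i * iota c / 2 ^+ i = iota c by rewrite mulrAC divff // mul1r.
  have e2 : 2 ^+ i.+1 * iota c'' / 2 ^+ i = 2 * iota c''.
    by rewrite exprS mulrAC mulfK.
  rewrite /bi /qi bve qvE e1 e2 => /eqP; rewrite subr_eq => /eqP h.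
  apply: (two_prime (b := b + c'')); apply: iota_inj.
  by rewrite rmorphXn h rmorphM rmorphD rmorph_nat mulrDr.
have [b bE] : exists b, bV v (x - iota a *: e) = 2 ^+ i.+1 * iota b.
  by rewrite bVC; apply/congr_biP/hx.
exists (b + a * c').
rewrite -[x in LHS](subrK (iota a *: e)) bVE bilinDr -bVE bE bilinZr -bVE bve cE.
by rewrite exprS rmorphD !rmorphM rmorph_nat; ring.
Qed.

(** Chosen to be stable under products: W_j and Y_j land in X_j, where the third clause takes over.
    The conditions on B_j and Z_j follow, since they lie in A_j and Y_j. *)
Definition compat (T : 'M[A]_n) : Prop := forall j, [/\
  forall x, latA j x -> latB j (map_mx iota T *m x),
  forall x, latW j x -> capl (latX j) (latZ j) (map_mx iota T *m x),
  forall x, latX j x -> capl (latX j) (latZ j) (map_mx iota T *m x)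
  & forall x, latY j x -> capl (latX j) (latZ j) (map_mx iota T *m x)].

Definition adjoint (T T' : 'M[A]_n) : Prop := forall x y,
  bV (map_mx iota T *m x) y = bV x (map_mx iota T' *m y).

(** The adjoint carries the condition on dual lattices: if T' maps W into X ∩ Z, then T maps the
    dual of X ∩ Z into the dual of W. *)
Definition good (T : 'M[A]_n) : Prop :=
  exists T', [/\ compat T, compat T' & adjoint T T'].

Lemma compatM T T' : compat T -> compat T' -> compat (T *m T').
Proof.
move=> cT cT' j; have [tA tW tX tY] := cT j; have [tA' tW' tX' tY'] := cT' j.
by rewrite map_mxM; split=> x hx; rewrite -mulmxA;
  [have [] := tA' _ hx => h _; apply: tA
  | have [] := tW' _ hx => h _; apply: tX
  | have [] := tX' _ hx => h _; apply: tX
  | have [] := tY' _ hx => h _; apply: tX].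
Qed.

Lemma goodM T T' : good T -> good T' -> good (T *m T').
Proof.
move=> [S [cT cS TS]] [S' [cT' cS' TS']]; exists (S' *m S).
split; try exact: compatM.
by move=> x y; rewrite !map_mxM -!mulmxA TS TS'.
Qed.

(** The row [w^T] is the functional b_i(v,-), written over A without dividing. *)
Lemma rank1_apply i (v v' w : 'cV[A]_n) x : G *m v = 2 ^+ i *: w ->
  map_mx iota (v' *m w^T) *m x = (bV (map_mx iota v) x / 2 ^+ i) *: map_mx iota v'.
Proof.
move=> vw; rewrite map_mxM -mulmxA [map_mx iota w^T *m x]mx11_scalar mul_mx_scalar.
congr (_ *: _); apply: (mulIf (pow2 i)); rewrite divfK // bVE /bilin.
have -> : (map_mx iota v)^T *m map_mx iota G = 2 ^+ i *: map_mx iota w^T.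
  rewrite -[in LHS]GF_sym -trmx_mul -map_mxM vw map_mxZ rmorphXn rmorph_nat.
  by rewrite linearZ /= map_trmx.
by rewrite -scalemxAl [RHS]mxE mulrC.
Qed.

(** At [j = i] the functional b_i(v,-) is even on W_i by [latB_latW], on X_i because [v] lies in
    A_i, and on Y_i because [v] lies in B_i. *)
Lemma rank1_compat i (v v' w : 'cV[A]_n) : G *m v = 2 ^+ i *: w ->
  latB i (map_mx iota v) -> latB i (map_mx iota v') -> compat (v' *m w^T).
Proof.
move=> vw Bv Bv' j; split=> x hx; rewrite (rank1_apply _ _ vw).
- have [ji|ji] := eqVneq j i; first by subst j; apply: latB_A_B.
  have [] // := latB_XZ Bv Bv' hx; first by move=> e; rewrite e eqxx in ji.
  by move=> _ [[]].
- apply: latB_XZ => //; first by case: hx.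
  by move=> ji; subst j; apply: latB_latW.
- apply: latB_XZ => //; first by case: hx.
  move=> ji; rewrite bVC; apply/congr_biP; rewrite -ji; case: hx => _; apply.
  by rewrite ji; case: Bv.
- apply: latB_XZ => //; first by case: hx => -[].
  move=> ji; rewrite bVC; apply/congr_biP; rewrite -ji; case: hx => _; apply.
  by rewrite ji.
Qed.

Lemma rank1_good i (v v' w w' : 'cV[A]_n) :
  G *m v = 2 ^+ i *: w -> G *m v' = 2 ^+ i *: w' ->
  latB i (map_mx iota v) -> latB i (map_mx iota v') -> good (v' *m w^T).
Proof.
move=> vw vw' Bv Bv'; exists (v *m w'^T); split.
- exact: rank1_compat vw Bv Bv'.
- exact: rank1_compat vw' Bv' Bv.
- move=> x y; rewrite (rank1_apply _ _ vw) (rank1_apply _ _ vw').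
  rewrite bVE bilinZl -bVE [RHS]bVE bilinZr -bVE [bV x _]bVC; ring.
Qed.

Section Points.

Variables (R : comNzRingType) (u : {rmorphism A -> R}).

Lemma Mpt_mspan (m : 'M[R]_n) : mspan u good (m - 1%:M) -> Mpt iota q u m.
Proof.
move=> hm i.
have XA x : latX i x -> latA i x by case.
have YB x : latY i x -> latB i x by case.
have ZY x : latZ i x -> latY i x by case.
have BA x : latB i x -> latA i x by case.
split; [split|split|split] => N _ _ x Mx.
- apply: (mspan_maps1 (E := good)) => // T [S [cT _ _]] v hv.
  by apply/BA; have [tA _ _ _] := cT i; apply: tA.
- apply: (mspan_maps1 (E := good)) => // T [S [cT _ _]] v /BA hv.
  by have [tA _ _ _] := cT i; apply: tA.
- apply: (mspan_maps1 (E := good)) => // T [S [cT _ _]] v hv.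
  have [_ tW _ _] := cT i; have [hX _] := tW _ hv; have [hA [e [_ [he _]]]] := hv.
  split; first exact: XA.
  (* X_i is contained in W_i through the multiple 0 of e; the vector e itself is supplied by
     [hv]. *)
  by exists e, 0; split=> //; rewrite rmorph0 scale0r subr0.
- apply: (mspan_maps1 (E := good)) => // T [S [cT _ _]] v hv.
  by have [_ _ tX _] := cT i; case: (tX _ hv).
- apply: (mspan_maps1 (E := good)) => // T [S [cT _ _]] v hv.
  by have [_ _ _ tY] := cT i; case: (tY _ hv) => _ /ZY.
- apply: (mspan_maps1 (E := good)) => // T [S [cT _ _]] v /ZY hv.
  by have [_ _ _ tY] := cT i; case: (tY _ hv).
- apply: (mspan_maps (E := good)) Mx => // T [S [cT _ _]] v hv.
  by have [tA _ _ _] := cT i; apply: tA.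
- apply: (mspan_maps (E := good)) Mx => // T [S [cT _ _]] v hv.
  by have [_ tW _ _] := cT i; apply: tW.
- apply: (mspan_maps (E := good)) Mx => // T [S [_ cS TS]] v hv y hy.
  by rewrite TS; apply: hv; have [_ tW _ _] := cS i; apply: tW.
Qed.

End Points.

End LatticeTheory.

(** * The Gram matrix of the integral form *)

Section Gram.

Variables (A : comNzRingType) (n : nat) (q : 'cV[A]_n -> A).
Hypothesis hq : quadratic_form q.

Lemma polar_sym x y : polar q x y = polar q y x.
Proof. by rewrite /polar [x + y]addrC addrAC. Qed.

Lemma polar_sum x y : polar q x y = \sum_j x j 0 * polar q (delta_mx j 0) y.
Proof.
have [_ pD pZ] := hq.
have p0 : polar q 0 y = 0 by rewrite -(scale0r 0) pZ mul0r.
rewrite {1}[x]matrix_sum_delta (eq_bigr (fun j => x j 0 *: delta_mx j 0)).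
  rewrite (big_morph (fun z => polar q z y) (fun a b => pD a b y) p0).
  by apply: eq_bigr => j _; rewrite pZ.
by move=> j _; rewrite big_ord1.
Qed.

Definition polar_mx : 'M[A]_n := \matrix_(j, l) polar q (delta_mx j 0) (delta_mx l 0).

Lemma polar_mxP x y : polar q x y = bilin polar_mx x y.
Proof.
rewrite polar_sum bilin_sum; apply: eq_bigr => j _.
rewrite polar_sym polar_sum mulr_sumr; apply: eq_bigr => l _.
by rewrite mxE polar_sym; ring.
Qed.

Lemma polar_mx_sym : polar_mx^T = polar_mx.
Proof. by apply/matrixP => j l; rewrite !mxE polar_sym. Qed.

Lemma polar_mx_diag j : polar_mx j j = 2 * q (delta_mx j 0).
Proof.
have [qZ _ _] := hq.
rewrite mxE /polar -[delta_mx j 0 + _]mulr2n -scaler_nat qZ; ring.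
Qed.

(** Both sides have the same polar form, so their difference is additive; it vanishes on multiples
    of the basis vectors. *)
Lemma quadratic_form_quad x : q x = quad (fun j => q (delta_mx j 0)) polar_mx x.
Proof.
have [qZ _ _] := hq; set Q := quad _ _.
have QD a b := quadD polar_mx_sym polar_mx_diag a b.
pose f z := q z - Q z.
have fD a b : f (a + b) = f a + f b.
  by rewrite /f /Q QD -polar_mxP /polar; ring.
have fZ a z : f (a *: z) = a ^+ 2 * f z by rewrite /f qZ /Q quadZ mulrBr.
have f0 : f 0 = 0 by rewrite -(scale0r 0) fZ expr0n mul0r.
apply/eqP; rewrite -subr_eq0 -/(f x); apply/eqP.
rewrite [x]matrix_sum_delta (eq_bigr (fun j => x j 0 *: delta_mx j 0)); last first.
  by move=> j _; rewrite big_ord1.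
rewrite (big_morph f fD f0) big1 // => j _.
by rewrite fZ /f /Q quad_delta subrr mulr0.
Qed.

Lemma quad_gram (R : comNzRingType) (u : {rmorphism A -> R}) (G : 'M[A]_n) x :
  G^T = G -> (forall j, q (delta_mx j 0) = G j j) -> polar_mx = 2 *: G ->
  qext u q x = bilin (map_mx u G) x x.
Proof.
move=> Gs Gd G2; rewrite bilin_sum sum_split_diag /qext; congr (_ + _).
  by apply: eq_bigr => j _; rewrite Gd mxE; ring.
apply: eq_bigr => j _; apply: eq_bigr => l _.
have -> : polar q (delta_mx j 0) (delta_mx l 0) = 2 * G j l.
  by have /matrixP/(_ j l) := G2; rewrite !mxE.
have -> : map_mx u G l j = u (G j l) by rewrite -[in LHS]Gs !mxE.
by rewrite rmorphM rmorph_nat mxE; ring.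
Qed.

End Gram.

(** Integrality of the bilinear form says that the polar matrix is divisible by 2; cancelling 2
    gives symmetry and the diagonal. *)
Lemma exists_gram (F : fieldType) (A : idomainType) (iota : {rmorphism A -> F})
    n (q : 'cV[A]_n -> A) :
  injective iota -> 2 != 0 :> F -> quadratic_form q -> integral_form iota q ->
  exists G : 'M[A]_n, [/\ G^T = G, forall j, q (delta_mx j 0) = G j j &
    polar_mx q = 2 *: G].
Proof.
move=> inj two hq hint.
have two_A : 2 != 0 :> A.
  by apply: contraNneq two => e; rewrite -(rmorph_nat iota) e rmorph0.
have bVP x y : bV iota q (map_mx iota x) (map_mx iota y) * 2 =
    iota (bilin (polar_mx q) x y).
  rewrite /bV divfK //.
  have qE z : qV iota q (map_mx iota z) =
      iota (quad (fun j => q (delta_mx j 0)) (polar_mx q) z).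
    rewrite quad_map /qV /qext /quad; congr (_ + _); apply: eq_bigr => j _.
    by apply: eq_bigr => l _; rewrite !mxE.
  rewrite -map_mxD !qE -!rmorphB quadD; first by congr (iota _); ring.
    exact: polar_mx_sym.
  exact: polar_mx_diag.
have hG (jl : 'I_n * 'I_n) : exists a : A, polar_mx q jl.1 jl.2 = a * 2.
  have [||a aE] := hint (map_mx iota (delta_mx jl.1 0)) (map_mx iota (delta_mx jl.2 0)).
  - by exists (delta_mx jl.1 0).
  - by exists (delta_mx jl.2 0).
  exists a; apply: inj; rewrite rmorphM rmorph_nat -aE bVP.
  by rewrite bilin_delta.
have [f fE] := fin_all_exists hG.
pose G := \matrix_(j, l) f (j, l).
have GE : polar_mx q = 2 *: G.
  by apply/matrixP => j l; rewrite !mxE -[RHS]mulrC -(fE (j, l)) mxE.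
exists G; split=> //.
  apply/matrixP => j l; apply: (mulfI two_A).
  by have /matrixP/(_ j l) := polar_mx_sym q; rewrite GE linearZ /= !mxE.
move=> j; apply: (mulfI two_A); rewrite -polar_mx_diag // GE mxE //.
Qed.

(** * Coordinates on B_i/Z_i *)

Section Lifting.

Variables (F : fieldType) (A : idomainType) (iota : {rmorphism A -> F}).
Hypotheses (two_F : 2 != 0 :> F) (two_A : 2 != 0 :> A).
Hypothesis two_prime : forall a b : A, a ^+ 2 = 2 * b -> exists c, a = 2 * c.
Hypothesis iota_inj : injective iota.
Variables (n : nat) (q : 'cV[A]_n -> A) (G : 'M[A]_n).
Hypothesis G_sym : G^T = G.
Hypothesis qE : forall x, q x = bilin G x x.
Hypothesis qVE : forall x, qV iota q x = bilin (map_mx iota G) x x.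
Variables (k : fieldType) (pi : {rmorphism A -> k}) (hk : is_quotient_mod2 pi).

Let pow2A i : 2 ^+ i != 0 :> A.
Proof. exact: expf_neq0. Qed.

Lemma bV_iota x y : bV iota q (map_mx iota x) (map_mx iota y) = iota (bilin G x y).
Proof. by rewrite (bVE two_F G_sym qVE) -bilin_map. Qed.

Lemma bV_iota_eq i x y a :
  bV iota q (map_mx iota x) (map_mx iota y) = 2 ^+ i * iota a ->
  bilin G x y = 2 ^+ i * a.
Proof.
rewrite bV_iota -(rmorph_nat iota) -rmorphXn -rmorphM; exact: iota_inj.
Qed.

Lemma qV_iota_eq i x a :
  qV iota q (map_mx iota x) = 2 ^+ i * iota a -> bilin G x x = 2 ^+ i * a.
Proof.
rewrite qVE -bilin_map -(rmorph_nat iota) -rmorphXn -rmorphM; exact: iota_inj.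
Qed.

Section Basis.

Variables (i d : nat) (beta : 'M[A]_(n, d)).
Hypothesis hbeta : is_basis_Vbar iota q pi i beta.

(* omega represents the functionals b_i(-, beta_t); the matrix omega^T beta is
   the polar form of the quadratic form 2^(-i-1) q in the coordinates beta,
   and D t is the value of that quadratic form at beta_t. *)
Definition basis_data (omega : 'M[A]_(n, d)) (D : 'I_d -> A) : Prop :=
  [/\ G *m beta = 2 ^+ i *: omega,
      (omega^T *m beta)^T = omega^T *m beta
    & forall t, (omega^T *m beta) t t = 2 * D t].

Lemma latB_beta c : latB iota q i (map_mx iota (beta *m c)).
Proof. by have [h _ _] := hbeta. Qed.

Lemma latB_col t : latB iota q i (map_mx iota (col t beta)).
Proof. by rewrite colE; apply: latB_beta. Qed.

Lemma exists_basis_data : exists omega D, basis_data omega D.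
Proof.
have hw (lt : 'I_n * 'I_d) : exists a, (G *m beta) lt.1 lt.2 = 2 ^+ i * a.
  have /latAP[//|_ /(_ (map_mx iota (delta_mx lt.1 0)))] := proj1 (latB_col lt.2).
  case; first by exists (delta_mx lt.1 0).
  move=> a /bV_iota_eq e; exists a.
  by rewrite -e bilin_sym // bilin_deltal colE mulmxA -colE [RHS]mxE.
have [f fE] := fin_all_exists hw.
pose omega := \matrix_(l, t) f (l, t).
have oE : G *m beta = 2 ^+ i *: omega.
  by apply/matrixP => l t; rewrite (fE (l, t)) !mxE.
have hE : 2 ^+ i *: (omega^T *m beta) = beta^T *m G *m beta.
  by rewrite scalemxAl -linearZ /= -oE trmx_mul G_sym.
have hs : (omega^T *m beta)^T = omega^T *m beta.
  apply/matrixP => s t; apply: (mulfI (pow2A i)).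
  have : (2 ^+ i *: (omega^T *m beta))^T = 2 ^+ i *: (omega^T *m beta).
    by rewrite hE !trmx_mul trmxK G_sym mulmxA.
  by rewrite linearZ /= => /matrixP/(_ s t); rewrite !mxE.
have hD t : exists a, (omega^T *m beta) t t = 2 * a.
  have /latBP[//|_ [a]] := latB_col t.
  move/qV_iota_eq => e; exists a; apply: (mulfI (pow2A i)).
  by rewrite mulrA -exprSr -e bilin_coll colE mulmxA -hE -colE [RHS]mxE [RHS]mxE.
have [D DE] := fin_all_exists hD.
by exists omega, D.
Qed.

Variables (omega : 'M[A]_(n, d)) (D : 'I_d -> A).
Hypothesis data : basis_data omega D.
Local Notation h := (omega^T *m beta).

Let oE : G *m beta = 2 ^+ i *: omega. Proof. by case: data. Qed.
Let hs : h^T = h. Proof. by case: data. Qed.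
Let hD t : h t t = 2 * D t. Proof. by case: data. Qed.

Section OverRing.
Variables (R : comNzRingType) (u : {rmorphism A -> R}).

Let hsR : (map_mx u h)^T = map_mx u h.
Proof. by rewrite map_trmx hs. Qed.
Let hDR t : (map_mx u h) t t = 2 * (u \o D) t.
Proof. by rewrite mxE hD rmorphM rmorph_nat. Qed.

Lemma gram_beta : map_mx u G *m map_mx u beta = 2 ^+ i *: map_mx u omega.
Proof. by rewrite -map_mxM oE map_mxZ rmorphXn rmorph_nat. Qed.

Lemma bilin_beta c c' : bilin (map_mx u G) (map_mx u beta *m c) (map_mx u beta *m c') =
  2 ^+ i * bilin (map_mx u h) c c'.
Proof.
rewrite /bilin -!mulmxA [map_mx u G *m _]mulmxA gram_beta trmx_mul -!mulmxA.
have -> : (map_mx u beta)^T *m ((2 ^+ i *: map_mx u omega) *m c') =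
    2 ^+ i *: (map_mx u h *m c').
  rewrite -scalemxAl -scalemxAr mulmxA; congr (_ *: (_ *m _)).
  by rewrite -hs trmx_mul trmxK map_mxM map_trmx.
by rewrite -scalemxAr mxE.
Qed.

Lemma quad_beta c : bilin (map_mx u G) (map_mx u beta *m c) (map_mx u beta *m c) =
  2 ^+ i.+1 * quad (u \o D) (map_mx u h) c.
Proof. by rewrite bilin_beta (bilin_diag hsR hDR) exprSr mulrA. Qed.

End OverRing.

Let map_id (m' n' : nat) (M : 'M[A]_(m', n')) : map_mx idfun M = M.
Proof. exact: map_mx_id. Qed.

Lemma q_beta c : q (beta *m c) = 2 ^+ i.+1 * quad D h c.
Proof. by have := quad_beta idfun c; rewrite !map_id -qE. Qed.

Lemma bilin_beta_A c c' : bilin G (beta *m c) (beta *m c') = 2 ^+ i * bilin h c c'.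
Proof. by have := bilin_beta idfun c c'; rewrite !map_id. Qed.

Lemma lift_vector m (x : 'cV[k]_m) : exists c, x = map_mx pi c.
Proof.
have [c cE] := fin_all_exists (fun t => proj1 hk (x t 0)).
exists (\col_t c t); apply/matrixP => t o; rewrite ord1 !mxE; exact: cE.
Qed.

(** A singular vector of the polar radical lifts to [beta *m c] in Z_i: it pairs evenly with the
    span of [beta], and with Z_i because Z_i lies in Y_i, hence with all of B_i. Freeness of [beta]
    then kills its residue. *)
Lemma residue_nonsingular : nonsingular (pi \o D) (map_mx pi h).
Proof.
move=> x hx qx; have [c cE] := lift_vector x.
have [_ hspan hfree] := hbeta.
rewrite cE; apply: hfree.
have pi0 a : pi a = 0 -> exists b, a = 2 * b by move/(proj2 hk).
have two_iota j a : iota (2 ^+ j * a) = 2 ^+ j * iota a.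
  by rewrite rmorphM rmorphXn rmorph_nat.
split; last first.
  have [a aE] : exists a, quad D h c = 2 * a.
    by apply: pi0; rewrite quad_map -cE.
  apply/(congr_qiP iota two_F); exists a; rewrite qVE -bilin_map -qE q_beta aE.
  by rewrite mulrA -exprSr two_iota.
split; first exact: latB_beta.
move=> y By; have [c' Zy] := hspan _ By.
apply/(congr_biP iota two_F).
have [a aE] : exists a, bilin h c c' = 2 * a.
  by apply: pi0; rewrite bilin_map -cE.
have [b bE] : exists b,
    bV iota q (map_mx iota (beta *m c)) (y - map_mx iota (beta *m c')) =
    2 ^+ i.+1 * iota b.
  rewrite (bVC two_F G_sym qVE); apply/(congr_biP iota two_F).
  have [[_ hY] _] := Zy; apply: hY; exact: latB_beta.
exists (b + a).
rewrite -[y in LHS](subrK (map_mx iota (beta *m c'))) (bVE two_F G_sym qVE) bilinDr.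
rewrite -!(bVE two_F G_sym qVE) bE bV_iota bilin_beta_A aE mulrA -exprSr two_iota.
by rewrite rmorphD mulrDr.
Qed.

Lemma qbarE (qbar : 'cV[k]_d -> k) : is_qbar q pi i beta qbar ->
  forall x, qbar x = quad (pi \o D) (map_mx pi h) x.
Proof.
move=> hqbar x; have [c ->] := lift_vector x.
by rewrite (hqbar c _ (q_beta c)) quad_map.
Qed.

Lemma qext_qbar (qbar : 'cV[k]_d -> k) (K : comNzRingType) (w : {rmorphism k -> K}) x :
  is_qbar q pi i beta qbar ->
  qext w qbar x = quad (w \o (pi \o D)) (map_mx w (map_mx pi h)) x.
Proof.
move=> hqbar; have qE' := qbarE hqbar.
have hsk : (map_mx pi h)^T = map_mx pi h by rewrite map_trmx hs.
have hDk t : map_mx pi h t t = 2 * (pi \o D) t by rewrite mxE hD rmorphM rmorph_nat.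
rewrite /qext /quad; congr (_ + _); apply: eq_bigr => j _.
  by rewrite qE' quad_delta.
apply: eq_bigr => l _; congr (_ * _ * _); rewrite [RHS]mxE; congr (w _).
rewrite /polar !qE' (quadD hsk hDk) bilin_delta.
by set a := quad _ _ _; set b := quad _ _ _; set c := map_mx _ _ _ _; ring.
Qed.

Section Residue.

Variables (R : comNzRingType) (u : {rmorphism A -> R}).
Hypothesis reg : forall a y, a != 0 -> u a * y = 0 -> y = 0.
Variables (K : fieldType) (theta : {rmorphism k -> K}) (rho : {rmorphism R -> K}).
Hypothesis rho_u : forall a, rho (u a) = theta (pi a).
Hypothesis rho_unit : forall r, rho r != 0 -> exists r', r * r' = 1.

Let rho_two r : rho (2 * r) = 0.
Proof.
rewrite rmorphM rmorph_nat -(rmorph_nat theta) -(rmorph_nat pi).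
have -> : pi 2 = 0 by apply/(proj2 hk); exists 1; rewrite mulr1.
by rewrite rmorph0 mul0r.
Qed.

Let map_rho_u (m' n' : nat) (M : 'M[A]_(m', n')) :
  map_mx rho (map_mx u M) = map_mx theta (map_mx pi M).
Proof. by apply/matrixP => a b; rewrite !mxE rho_u. Qed.

Let powI j (a b : R) : 2 ^+ j * a = 2 ^+ j * b -> a = b.
Proof.
move=> /eqP; rewrite -subr_eq0 -mulrBr -(rmorph_nat u) -rmorphXn => /eqP.
by move/(reg (pow2A j))/eqP; rewrite subr_eq0 => /eqP.
Qed.

Lemma rho_quad c : rho (quad (u \o D) (map_mx u h) c) =
  quad (theta \o (pi \o D)) (map_mx theta (map_mx pi h)) (map_mx rho c).
Proof.
rewrite quad_map map_rho_u /quad; congr (_ + _); apply: eq_bigr => t _.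
by rewrite /= rho_u.
Qed.

Lemma latZ_omega z : base_change iota u 0 (latZ iota q i) z ->
  exists r : 'cV_d, (map_mx u omega)^T *m z = 2 *: r.
Proof.
elim/base_change_ind: z / => [|z z' [r e] [r' e']|a y v Zv].
- by exists 0; rewrite mulmx0 scaler0.
- by exists (r + r'); rewrite mulmxDr e e' scalerDr.
rewrite expr0 scale1r => yv; rewrite -yv in Zv.
have hb s : exists b, (omega^T *m y) s 0 = 2 * b.
  have /(congr_biP iota two_F)[b /bV_iota_eq e] := proj2 (proj1 Zv) _ (latB_col s).
  exists b; apply: (mulfI (pow2A i)); rewrite mulrA -exprSr -e bilin_sym //.
  by rewrite bilin_coll -[in RHS]G_sym -trmx_mul oE linearZ /= -scalemxAl [RHS]mxE.
have [b bE] := fin_all_exists hb.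
exists (a *: map_mx u (\col_s b s)); rewrite -scalemxAr map_trmx -map_mxM.
apply/matrixP => s o; rewrite ord1 [LHS]mxE [in LHS]mxE bE !mxE rmorphM rmorph_nat.
by rewrite mulrCA.
Qed.

Lemma latZ_bilin z z' : base_change iota u 0 (latZ iota q i) z ->
  base_change iota u 0 (latZ iota q i) z' ->
  exists r, bilin (map_mx u G) z z' = 2 ^+ i.+1 * r.
Proof.
move=> hz hz'; elim/base_change_ind: z / hz => [|x x' [r e] [r' e']|a y v Zv].
- by exists 0; rewrite bilin0l mulr0.
- by exists (r + r'); rewrite bilinDl e e' mulrDr.
rewrite expr0 scale1r => yv; rewrite -yv in Zv.
elim/base_change_ind: z' / hz' => [|x x' [r e] [r' e']|a' y' v' Zv'].
- by exists 0; rewrite bilin0r mulr0.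
- by exists (r + r'); rewrite bilinDr e e' mulrDr.
rewrite expr0 scale1r => yv'; rewrite -yv' in Zv'.
have /(congr_biP iota two_F)[b /bV_iota_eq e] := proj2 (proj1 Zv) _ (proj1 (proj1 Zv')).
exists (a * a' * u b); rewrite bilinZl bilinZr -bilin_map e rmorphM rmorphXn rmorph_nat.
by ring.
Qed.

Lemma latZ_quad z : base_change iota u 0 (latZ iota q i) z ->
  exists r, bilin (map_mx u G) z z = 2 ^+ i.+2 * r.
Proof.
(* Membership is kept in the induction because the cross term of a sum is controlled by
   [latZ_bilin]. *)
move=> hz; suff [] : base_change iota u 0 (latZ iota q i) z /\
  exists r, bilin (map_mx u G) z z = 2 ^+ i.+2 * r by [].
elim/base_change_ind: z / hz => [|x x' [hx [r e]] [hx' [r' e']]|a y v Zv yv].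
- by split; [exact: base_change0|exists 0; rewrite bilin0l mulr0].
- split; first exact: base_changeD.
  have [b bE] := latZ_bilin hx hx'.
  exists (r + r' + b); rewrite !bilinE e e' [bilin _ x' x]bilin_sym.
    by rewrite bE !exprS; ring.
  by rewrite map_trmx G_sym.
split; first exact: base_change_gen Zv yv.
move: yv; rewrite expr0 scale1r => yv; rewrite -yv in Zv.
have /(congr_qiP iota two_F)[b /qV_iota_eq e] := proj2 Zv.
exists (a * a * u b); rewrite bilinZl bilinZr -bilin_map e rmorphM rmorphXn rmorph_nat.
by ring.
Qed.

(** Linear independence of [beta] modulo Z_i, transported to K': [c] reduces to a singular vector of
    the polar radical. *)
Lemma latZ_beta (c : 'cV[R]_d) :
  nonsingular (theta \o (pi \o D)) (map_mx theta (map_mx pi h)) ->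
  base_change iota u 0 (latZ iota q i) (map_mx u beta *m c) -> map_mx rho c = 0.
Proof.
move=> ns Zc; apply: ns.
  move=> y; have [r e] := latZ_omega Zc.
  have hc : map_mx theta (map_mx pi h) *m map_mx rho c = 0.
    have hE : map_mx u h = (map_mx u omega)^T *m map_mx u beta.
      by rewrite map_mxM map_trmx.
    rewrite -map_rho_u -map_mxM hE -mulmxA e.
    by apply/matrixP => s o; rewrite !mxE rho_two.
  have hsK : (map_mx theta (map_mx pi h))^T = map_mx theta (map_mx pi h).
    by rewrite !map_trmx hs.
  by rewrite bilin_sym // /bilin -mulmxA hc mulmx0 mxE.
have [r e] := latZ_quad Zc; rewrite -rho_quad.
have -> : quad (u \o D) (map_mx u h) c = 2 * r.
  by apply: (powI (j := i.+1)); rewrite -quad_beta e mulrA -exprSr.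
exact: rho_two.
Qed.

End Residue.

End Basis.

(** * Lifting reflections to isometries over R *)

Section LiftedIsometries.

Variables (d : nat -> nat) (beta : forall i, 'M[A]_(n, d i)).
Hypothesis hbeta : forall i, is_basis_Vbar iota q pi i (beta i).
Variables (R : comNzRingType) (u : {rmorphism A -> R}).
Variables (K : fieldType) (theta : {rmorphism k -> K}) (rho : {rmorphism R -> K}).
Hypothesis rho_u : forall a, rho (u a) = theta (pi a).
Hypothesis rho_unit : forall r, rho r != 0 -> exists r', r * r' = 1.

(** Implies [Gpt], and is easily closed under products because [good] is. *)
Definition lifted (m : 'M[R]_n) : Prop :=
  [/\ mspan u (good iota q) (m - 1%:M),
      m^T *m map_mx u G *m m = map_mx u G
    & exists r, \det m * r = 1].

Definition acts i (m : 'M[R]_n) (C : 'M[R]_(d i)) : Prop :=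
  forall t, base_change iota u 0 (latZ iota q i)
    (col t (m *m map_mx u (beta i) - map_mx u (beta i) *m C)).

Arguments acts : clear implicits.

Lemma lifted1 : lifted 1%:M.
Proof.
split; first by rewrite subrr; apply: mspan0.
  by rewrite trmx1 mul1mx mulmx1.
by exists 1; rewrite det1 mulr1.
Qed.

Lemma liftedM m m' : lifted m -> lifted m' -> lifted (m *m m').
Proof.
move=> [sm im [r dm]] [sm' im' [r' dm']]; split.
- have -> : m *m m' - 1%:M = (m - 1%:M) *m (m' - 1%:M) + ((m - 1%:M) + (m' - 1%:M)).
    by rewrite mulmxBl mul1mx mulmxBr mulmx1 [RHS]addrACA addNr addr0 addrA subrK.
  apply: mspanD; last exact: mspanD.
  by apply: mspanM => // T T'; apply: goodM.
- rewrite trmx_mul.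
  have -> : m'^T *m m^T *m map_mx u G *m (m *m m') =
      m'^T *m (m^T *m map_mx u G *m m) *m m' by rewrite !mulmxA.
  by rewrite im.
- by exists (r * r'); rewrite det_mulmx mulrACA dm dm' mulr1.
Qed.

Lemma lifted_latZ i m x : lifted m -> base_change iota u 0 (latZ iota q i) x ->
  base_change iota u 0 (latZ iota q i) (m *m x).
Proof.
move=> [sm _ _] hx; apply: (mspan_maps1 _ sm hx) => T [T' [cT _ _]] v [hv _].
by have [_ _ _ tY] := cT i; case: (tY _ hv).
Qed.

Lemma acts1 i : acts i 1%:M 1%:M.
Proof.
move=> t; rewrite mul1mx mulmx1 subrr; have -> : col t 0 = 0 :> 'cV[R]_n.
  by apply/matrixP => a b; rewrite !mxE.
exact: base_change0.
Qed.

Lemma actsM i m m' C C' : lifted m -> acts i m C -> acts i m' C' ->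
  acts i (m *m m') (C *m C').
Proof.
move=> lm aC aC' t; set b := map_mx u (beta i).
have -> : col t (m *m m' *m b - b *m (C *m C')) =
    m *m col t (m' *m b - b *m C') + (m *m b - b *m C) *m col t C'.
  rewrite !colE (mulmxA m) (mulmxA (_ - _) C') -mulmxDl; congr (_ *m _).
  by rewrite mulmxBr mulmxBl !mulmxA addrA subrK.
apply: base_changeD; first exact: lifted_latZ.
exact: base_change_mulmx.
Qed.

(** [acts] determines the matrix only modulo Z_i, but its image in K' is unique; this allows any
    matrix chosen over A(M) to be compared with the explicit one. *)
Lemma acts_lifted_unique i m C C' omega D : basis_data i (beta i) omega D ->
  nonsingular (theta \o (pi \o D)) (map_mx theta (map_mx pi (omega^T *m beta i))) ->
  (forall a y, a != 0 -> u a * y = 0 -> y = 0) ->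
  acts i m C -> acts i m C' -> map_mx rho C = map_mx rho C'.
Proof.
move=> dat ns reg aC aC'; apply/eqP; rewrite -subr_eq0 -map_mxB; apply/eqP.
suff h t : map_mx rho (col t (C - C')) = 0.
  by apply/matrixP => a t; have /matrixP/(_ a 0) := h t; rewrite !mxE.
apply: (latZ_beta (hbeta i) dat reg rho_u ns).
have -> : map_mx u (beta i) *m col t (C - C') =
    -1 *: col t (m *m map_mx u (beta i) - map_mx u (beta i) *m C) +
    col t (m *m map_mx u (beta i) - map_mx u (beta i) *m C').
  rewrite !colE (mulmxA _ (C - C')) scaleN1r -mulNmx -mulmxDl; congr (_ *m _).
  by rewrite mulmxBr opprB addrA subrK.
by apply: base_changeD => //; apply: base_changeZ.
Qed.

Definition rank1_in i (T : 'M[A]_n) : Prop := exists v v' w w',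
  [/\ G *m v = 2 ^+ i *: w, G *m v' = 2 ^+ i *: w',
      latB iota q i (map_mx iota v), latB iota q i (map_mx iota v')
    & T = v' *m w^T].

Lemma rank1_in_good i T : rank1_in i T -> good iota q T.
Proof.
move=> [v [v' [w [w' [vw vw' Bv Bv' ->]]]]].
exact: (rank1_good two_F two_prime iota_inj G_sym qVE vw vw').
Qed.

Lemma rank1_in_latZ i j T x : rank1_in i T -> j != i -> latA iota q j x ->
  latZ iota q j (map_mx iota T *m x).
Proof.
move=> [v [v' [w [w' [vw vw' Bv Bv' ->]]]]] ji Ax.
rewrite (rank1_apply two_F G_sym qVE _ _ vw).
have [] // := latB_XZ two_F G_sym qVE Bv Bv' Ax.
by move=> e; rewrite e eqxx in ji.
Qed.

(** For a lift V of [v] to (B_i)_R, the coefficient 2<x,V>/q(V) equals b_i(V,x)/eps with eps =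
    q(V)/2^(i+1). The powers of 2 cancel, and eps is invertible since its residue [Q v] is
    nonzero. *)
Lemma lift_refl i omega D (v : 'cV[K]_(d i)) : basis_data i (beta i) omega D ->
  (forall t, exists r, rho r = v t 0) ->
  quad (theta \o (pi \o D)) (map_mx theta (map_mx pi (omega^T *m beta i))) v != 0 ->
  exists m, [/\ lifted m,
    exists2 C, acts i m C & map_mx rho C =
      refl (map_mx theta (map_mx pi (omega^T *m beta i)))
        (quad (theta \o (pi \o D)) (map_mx theta (map_mx pi (omega^T *m beta i)))) v
    & forall j, j != i -> acts j m 1%:M].
Proof.
move=> dat hv; set h := omega^T *m beta i; set H := map_mx theta _; set Q := quad _ H.
move=> Qv; have [oE hs hD] := dat; rewrite -/h in hs hD.
have [c0 c0E] := fin_all_exists hv; pose c := \col_t c0 t.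
have cE : map_mx rho c = v by apply/matrixP => t o; rewrite ord1 !mxE c0E.
pose eps := quad (u \o D) (map_mx u h) c.
have epsE : rho eps = Q v by rewrite /eps (rho_quad (beta i) omega D rho_u) cE.
have [eps' ee] : exists r, eps * r = 1 by apply: rho_unit; rewrite epsE.
set b := map_mx u (beta i); set o := map_mx u omega.
pose N := (b *m c) *m (o *m c)^T; pose m := 1%:M - eps' *: N.
have hsR : (map_mx u h)^T = map_mx u h by rewrite map_trmx hs.
have hDR t : (map_mx u h) t t = 2 * (u \o D) t by rewrite mxE hD rmorphM rmorph_nat.
have hE : map_mx u h = o^T *m b by rewrite /o /b map_trmx -map_mxM.
(* This is b_i(V,V) = 2 eps, whence [N *m N = (2 * eps) *: N], which makes [m] an involution and an
   isometry. *)
have ob : (o *m c)^T *m (b *m c) = (2 * eps)%:M.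
  rewrite trmx_mul -mulmxA (mulmxA o^T) -hE mulmxA [LHS]mx11_scalar.
  by rewrite -(bilin_diag hsR hDR).
have Gb : map_mx u G *m (b *m c) = 2 ^+ i *: (o *m c).
  by rewrite mulmxA (gram_beta dat) -scalemxAl.
have bG : (b *m c)^T *m map_mx u G = 2 ^+ i *: (o *m c)^T.
  have <- : (map_mx u G)^T = map_mx u G by rewrite map_trmx G_sym.
  by rewrite -trmx_mul Gb linearZ.
have mT : m^T = 1%:M - eps' *: ((o *m c) *m (b *m c)^T).
  by rewrite /m linearB /= trmx1 linearZ /= trmx_mul trmxK.
have sN : mspan u (rank1_in i) (m - 1%:M).
  (* Expanding V in the columns of [beta] moves the coefficients from R out of operators defined
     over A. *)
  have -> : m - 1%:M = \sum_t \sum_s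
      (- eps' * c t 0 * c s 0) *: map_mx u (col t (beta i) *m (col s omega)^T).
    rewrite /m addrC addKr; apply/matrixP => a e; rewrite !mxE big_ord1 !mxE.
    rewrite summxE mulr_suml mulr_sumr -sumrN; apply: eq_bigr => t _.
    rewrite summxE !mulr_sumr -sumrN; apply: eq_bigr => s _.
    by rewrite !mxE big_ord1 !mxE rmorphM; ring.
  apply: mspan_sum => t _; apply: mspan_sum => s _.
  rewrite -[_ *: _]addr0; apply: mspan_cons; last exact: mspan0.
  exists (col s (beta i)), (col t (beta i)), (col s omega), (col t omega).
  by split=> //; try exact: latB_col (hbeta i) _;
     rewrite !colE mulmxA oE -scalemxAl.
have mm : m *m m = 1%:M.
  rewrite {1}/m mulmxBl mul1mx /m mulmxBr mulmx1 -scalemxAl -scalemxAr.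
  have -> : N *m N = (2 * eps) *: N.
    by rewrite /N mulmxA -(mulmxA (b *m c)) ob mul_mx_scalar -scalemxAl.
  move: (N) => P; rewrite !scalerA; apply/matrixP => a e; rewrite !mxE.
  set x := P _ _; set y := (a == e)%:R.
  transitivity (y + 2 * (eps' * x) * (eps * eps' - 1)); first by ring.
  by rewrite ee subrr mulr0 addr0.
exists m; split.
- split.
  + by apply: mspanW sN => T; apply: rank1_in_good.
  + rewrite mT (mulmxBl 1%:M) mul1mx -scalemxAl -(mulmxA (o *m c)) bG -scalemxAr scalerA.
    rewrite /m mulmxBr mulmx1 mulmxBl -!scalemxAr -!scalemxAl.
    have -> : map_mx u G *m N = 2 ^+ i *: ((o *m c) *m (o *m c)^T).
      by rewrite /N mulmxA Gb -scalemxAl.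
    have -> : (o *m c) *m (o *m c)^T *m N = (2 * eps) *: ((o *m c) *m (o *m c)^T).
      by rewrite /N mulmxA -(mulmxA (o *m c)) ob mul_mx_scalar -scalemxAl.
    move: (_ *m _^T) => P; rewrite !scalerA; apply/matrixP => a e; rewrite !mxE.
    set x := P _ _; set y := u _.
    transitivity (y + 2 * (eps' * 2 ^+ i * x) * (eps * eps' - 1)); first by ring.
    by rewrite ee subrr mulr0 addr0.
  + by exists (\det m); rewrite -det_mulmx mm det1.
- exists (1%:M - eps' *: (c *m (c^T *m map_mx u h))).
    move=> t; rewrite /m mulmxBl mul1mx mulmxBr mulmx1 -scalemxAl -scalemxAr.
    have -> : N *m b = b *m (c *m (c^T *m map_mx u h)).
      by rewrite /N trmx_mul hE !mulmxA.
    rewrite subrr; have -> : col t 0 = 0 :> 'cV[R]_n.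
      by apply/matrixP => x y; rewrite !mxE.
    exact: base_change0.
  have -> : H = map_mx rho (map_mx u h) by apply/matrixP => x y; rewrite !mxE rho_u.
  have eps'E : rho eps' = (Q v)^-1.
    apply: (mulfI (x := rho eps)); first by rewrite epsE.
    by rewrite -rmorphM ee rmorph1 epsE divff.
  rewrite map_mxB map_mx1 map_mxZ map_mxM (map_mxM rho c^T) -map_trmx cE eps'E.
  by [].
- move=> j ji t; rewrite mulmx1.
  have -> : m *m map_mx u (beta j) - map_mx u (beta j) =
      (m - 1%:M) *m map_mx u (beta j) by rewrite [RHS]mulmxBl mul1mx.
  rewrite colE -mulmxA -colE; apply: (mspan_maps (M := latA iota q j) _ sN).
    by move=> T ET x Ax; apply: (rank1_in_latZ ET ji Ax).
  have -> : col t (map_mx u (beta j)) = 1 *: map_mx u (col t (beta j)).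
    by rewrite scale1r map_col.
  apply: (@base_change_gen _ _ _ _ _ _ _ _ _ _ (map_mx iota (col t (beta j)))).
    by case: (latB_col (hbeta j) t).
  by rewrite expr0 scale1r.
Qed.

Definition lifts i (g : 'M[K]_(d i)) : Prop := exists m, [/\ lifted m,
  exists2 C, acts i m C & map_mx rho C = g
  & forall j, j != i -> acts j m 1%:M].

Arguments lifts : clear implicits.

(** The last premise is the induction principle produced by [refl_gen_support]: [g] is a product of
    reflections in vectors with entries in [l]. *)
Lemma lifts_isometry i omega D (g : 'M[K]_(d i)) (l : seq K) :
  basis_data i (beta i) omega D ->
  (forall x, x \in l -> exists r, rho r = x) ->
  (forall P : 'M[K]_(d i) -> Prop, P 1%:M ->
    (forall v g', quad (theta \o (pi \o D))
        (map_mx theta (map_mx pi (omega^T *m beta i))) v != 0 ->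
      (forall t, v t 0 \in l) -> P g' ->
      P (refl (map_mx theta (map_mx pi (omega^T *m beta i)))
        (quad (theta \o (pi \o D)) (map_mx theta (map_mx pi (omega^T *m beta i)))) v
        *m g')) -> P g) ->
  lifts i g.
Proof.
move=> dat hl; apply; first exists 1%:M.
  split; first exact: lifted1.
    by exists 1%:M; [exact: acts1 | rewrite map_mx1].
  by move=> j _; apply: acts1.
move=> v g' Qv vl [m' [lm' [C' aC' <-]] am'].
have [m [lm [C aC <-]] am] := lift_refl dat (fun t => hl _ (vl t)) Qv.
exists (m *m m'); split; first exact: liftedM.
  by exists (C *m C'); [apply: actsM | rewrite map_mxM].
by move=> j ji; rewrite -[1%:M]mulmx1; apply: actsM => //; [apply: am | apply: am'].
Qed.

(** Lifts for different indices do not interfere; trivial action from [i0] on is carried along so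
    that the next factor acts there alone. *)
Lemma lifts_family i0 (g : forall i, 'M[K]_(d i)) :
  (forall i, (i < i0)%N -> lifts i (g i)) ->
  exists m, lifted m /\ forall i,
    ((i < i0)%N -> exists2 C, acts i m C & map_mx rho C = g i) /\
    ((i0 <= i)%N -> acts i m 1%:M).
Proof.
elim: i0 => [|i0 IH] hg.
  by exists 1%:M; split; [exact: lifted1 | move=> i; split=> // _; apply: acts1].
have [|m [lm am]] := IH; first by move=> i hi; apply: hg; apply: ltnW.
have [m' [lm' [C' aC' C'E] am']] := hg i0 (ltnSn i0).
exists (m' *m m); split; first exact: liftedM.
move=> i; split=> hi; last first.
  rewrite -[1%:M]mulmx1; apply: actsM => //; first by apply: am'; rewrite gtn_eqF.
  by have [_ h] := am i; apply: h; apply: ltnW.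
have [ii|ii] := eqVneq i i0.
  subst i; exists (C' *m 1%:M); last by rewrite mulmx1.
  by apply: actsM => //; have [_ h] := am i0; apply: h.
have [C aC CE] : exists2 C, acts i m C & map_mx rho C = g i.
  by have [h _] := am i; apply: h; rewrite ltn_neqAle ii -ltnS.
by exists (1%:M *m C); [apply: actsM => //; apply: am' | rewrite mul1mx].
Qed.

End LiftedIsometries.

(** * Finiteness, and the choice of the ring R *)

(** By Cramer's rule A_i is contained in 4 L for these [i]. Writing elements as 4 y gains the two
    powers of 2 that put them in Z_i, so B_i = Z_i. *)
Lemma Vbar_trivial (d : nat -> nat) (beta : forall i, 'M[A]_(n, d i)) N b :
  (forall i, is_basis_Vbar iota q pi i (beta i)) -> \det G * b = 2 ^+ N ->
  forall i, (N.+2 <= i)%N -> d i = 0%N.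
Proof.
move=> hbeta dG i hi.
have quarter x : latA iota q i x -> exists y, x = map_mx iota (4 *: y).
  move=> /latAP[//|[y ->] hx].
  have hz (l : 'I_n) : exists a, (G *m y) l 0 = 2 ^+ i * a.
    have [|a /bV_iota_eq e] := hx (map_mx iota (delta_mx l 0)).
      by exists (delta_mx l 0).
    by exists a; rewrite -bilin_deltal bilin_sym.
  have [z zE] := fin_all_exists hz.
  have Gy : G *m y = 2 ^+ i *: \col_l z l.
    by apply/matrixP => l o; rewrite ord1 zE !mxE.
  exists (2 ^+ (i - N.+2) * b *: (\adj G *m \col_l z l)); congr (map_mx _ _).
  apply/matrixP => l o; apply: (mulfI (pow2A N)).
  have /matrixP/(_ l o) : \det G *: y = 2 ^+ i *: (\adj G *m \col_l z l).
    by rewrite -mul_scalar_mx -mul_adj_mx -mulmxA Gy -scalemxAr.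
  move: (_ *m _) => w; rewrite mxE [RHS]mxE => e.
  have iE : 2 ^+ i = 2 ^+ (i - N.+2) * 2 ^+ N * 4 :> A.
    by rewrite -{1}(subnK hi) exprD !exprS; ring.
  by rewrite -{1}dG mulrAC e iE !mxE; ring.
have AZ x : latA iota q i x -> latZ iota q i x.
  move=> Ax; have [y xE] := quarter _ Ax; have /latAP[//|Lx hx] := Ax.
  have four z : map_mx iota (4 *: z) = 4 *: map_mx iota z.
    by rewrite map_mxZ rmorph_nat.
  have qx : exists a, qV iota q x = 2 ^+ i.+2 * iota a.
    have [|a e] := hx (map_mx iota y); first by exists y.
    exists a; rewrite qVE {2}xE four bilinZr -(bVE two_F G_sym qVE) e !exprS; ring.
  have [a qa] := qx; have [] // := latXZ_intro two_F Ax _ qa.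
  move=> y' /quarter[z ->]; have [|c e] := hx (map_mx iota z); first by exists z.
  exists (2 * c); rewrite (bVE two_F G_sym qVE) four bilinZr -(bVE two_F G_sym qVE) e.
  by rewrite !exprS rmorphM rmorph_nat; ring.
have [hB _ hfree] := hbeta i.
(* The vector of ones would have zero residue, which is absurd unless it is empty. *)
have /matrixP h := hfree (const_mx 1) (AZ _ (proj1 (hB _))).
case: (d i) h => // m h.
by have /eqP := h ord0 0; rewrite !mxE rmorph1 oner_eq0.
Qed.

End Lifting.

Arguments acts {F A} iota {n} q {d} beta {R} u i m C.
Arguments lifts {F A} iota {n} q G {d} beta {R} u {K} rho i g.

(** The derivation of [refl_gen] must be replayed over R, but R depends on the entries of its
    vectors. The list [l] records these first, and quantifying over [P] keeps the derivation
    available. *)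
Lemma refl_gen_support (K : fieldType) d (H : 'M[K]_d) Q g : refl_gen H Q g ->
  exists l : seq K, forall P : 'M[K]_d -> Prop, P 1%:M ->
    (forall v g', Q v != 0 -> (forall t, v t 0 \in l) -> P g' ->
      P (refl H Q v *m g')) -> P g.
Proof.
elim=> [|v g' Qv _ [l IH]]; first by exists [::].
exists ([seq v t 0 | t <- enum 'I_d] ++ l) => P P1 PM; apply: (PM) => //.
  by move=> t; rewrite mem_cat (map_f (fun t => v t 0)) ?mem_enum.
apply: IH => // v' g'' Qv' hv' Pg; apply: PM => // t.
by rewrite mem_cat hv' orbT.
Qed.

Lemma quad_quadratic_form (R : comNzRingType) d (D : 'I_d -> R)
    (h g : 'M[R]_d) :
  h^T = h -> (forall j, h j j = 2 * D j) ->
  quadratic_form (fun x => quad D h (g *m x)).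
Proof.
move=> hs hD.
have pE x y : polar (fun x => quad D h (g *m x)) x y = bilin h (g *m x) (g *m y).
  by rewrite /polar mulmxDr (quadD hs hD); ring.
split=> [a x|x y z|a x y]; rewrite ?pE.
- by rewrite -scalemxAr quadZ.
- by rewrite mulmxDr bilinDl.
- by rewrite -scalemxAr bilinZl.
Qed.

(** The isometry identity is known only on vectors over K. Both sides are quadratic forms over K',
    determined by their values and polar values on the standard basis, which come from K. *)
Lemma quad_isometry_ext (K K' : fieldType) (j : {rmorphism K -> K'}) d
    (D : 'I_d -> K) (h g : 'M[K]_d) :
  h^T = h -> (forall t, h t t = 2 * D t) ->
  (forall x, quad D h (g *m x) = quad D h x) ->
  forall x, quad (j \o D) (map_mx j h) (map_mx j g *m x) = quad (j \o D) (map_mx j h) x.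
Proof.
move=> hs hD gQ x.
have hs' : (map_mx j h)^T = map_mx j h by rewrite map_trmx hs.
have hD' t : map_mx j h t t = 2 * (j \o D) t by rewrite mxE hD rmorphM rmorph_nat.
have q1 := quad_quadratic_form (map_mx j g) hs' hD'.
have q2 := quad_quadratic_form 1%:M hs' hD'.
rewrite (quadratic_form_quad q1) -[in RHS](mul1mx x) (quadratic_form_quad q2).
have dE t : delta_mx t 0 = map_mx j (delta_mx t 0) :> 'cV_d by rewrite map_delta_mx.
have gE z : quad (j \o D) (map_mx j h) (map_mx j g *m map_mx j z) =
    quad (j \o D) (map_mx j h) (1%:M *m map_mx j z).
  by rewrite mul1mx -map_mxM -!quad_map gQ.
apply: eq_quad => [t|]; first by rewrite dE gE.
by apply/matrixP => t l; rewrite !mxE /polar !dE -map_mxD !gE.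
Qed.

(** One variable per entry of [l], evaluated at that entry; localizing at the kernel inverts
    everything of nonzero residue. *)
Lemma exists_residue_lift (A : idomainType) (K : fieldType)
    (phi : {rmorphism A -> K}) (l : seq K) :
  exists (R : comNzRingType) (u : {rmorphism A -> R}) (rho : {rmorphism R -> K}),
  [/\ forall a, rho (u a) = phi a,
      forall a y, a != 0 -> u a * y = 0 -> y = 0,
      forall r, rho r != 0 -> exists r', r * r' = 1
    & forall x, x \in l -> exists r, rho r = x].
Proof.
pose S := {mpoly A[size l]}.
pose ev : {rmorphism S -> K} := mmap phi (fun t => l`_t).
exists (localization ev), (local_of ev \o (@mpolyC (size l) A)), (local_res (phi := ev)).
split=> [a|a y a0|r|x xl].
- by rewrite -[LHS]/(local_res (local_of ev a%:MP)) local_res_of; apply: mmapC.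
- by apply: local_of_reg; rewrite mpolyC_eq0.
- exact: local_res_unit.
have xs : (index x l < size l)%N by rewrite index_mem.
exists (local_of ev 'X_(Ordinal xs)).
rewrite -[LHS]/(local_res (local_of ev 'X_(Ordinal xs))) local_res_of.
by transitivity (l`_(index x l)); [rewrite [LHS]mmapX mmap1U | exact: nth_index].
Qed.

Lemma base_change_latB (F : fieldType) (A : idomainType) (iota : {rmorphism A -> F})
    n (q : 'cV[A]_n -> A) (k : fieldType) (pi : {rmorphism A -> k}) i d
    (beta : 'M[A]_(n, d)) (R : comNzRingType) (u : {rmorphism A -> R}) x :
  is_basis_Vbar iota q pi i beta -> base_change iota u 0 (latB iota q i) x ->
  exists c, base_change iota u 0 (latZ iota q i) (x - map_mx u beta *m c).
Proof.
move=> [_ hspan _]; elim/base_change_ind: x / => [|x x' [c e] [c' e']|r y v Bv].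
- by exists 0; rewrite mulmx0 subr0; apply: base_change0.
- by exists (c + c'); rewrite mulmxDr opprD addrACA; apply: base_changeD.
rewrite expr0 scale1r => yv; have [c Zc] := hspan _ Bv.
exists (r *: map_mx u c).
rewrite -scalemxAr -scalerBr -map_mxM -map_mxB.
by apply: (base_change_gen u _ Zc); rewrite expr0 scale1r map_mxB yv.
Qed.

(** * Assembly of the surjectivity of phi *)

Theorem theorem4p1
  (Q2 : fieldType) (nrm : Q2 -> rat) (hQ2 : is_Q2 nrm)
  (F : fieldExtType Q2) (A : idomainType) (iota : {rmorphism A -> F})
  (hA : is_ring_of_integers nrm iota) (hunr : is_unramified A)
  (k : fieldType) (pi : {rmorphism A -> k}) (hk : is_quotient_mod2 pi)
  (n : nat) (q : 'cV[A]_n -> A) (hq : quadratic_form q)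
  (hnd : nondegenerate_form iota q) (hint : integral_form iota q)
  (AM : comNzRingType) (s : {rmorphism A -> AM}) (univ : 'M[AM]_n)
  (hM : represents_M iota q s univ)
  (d : nat -> nat) (beta : forall i : nat, 'M[A]_(n, d i))
  (hbeta : forall i, is_basis_Vbar iota q pi i (beta i))
  (qbar : forall i : nat, 'cV[k]_(d i) -> k)
  (hqbar : forall i, is_qbar q pi i (beta i) (qbar i)) :
  phi_surjective iota q s univ pi beta qbar.
Proof.
move=> K w g hg.
have two_F := F_two_neq0 hQ2 F.
have two_A := A_two_neq0 hQ2 iota.
have iinj := iota_inj hA.
have char_k := residue_two hk.
have perfect := residue_perfect hQ2 hA hk.
have two_prime (a b : A) : a ^+ 2 = 2 * b -> exists c, a = 2 * c.
  move=> e; apply/(proj2 hk)/eqP; rewrite -sqrf_eq0 -rmorphXn e rmorphM rmorph_nat.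
  by rewrite char_k mul0r.
have [G [G_sym Gd G2]] := exists_gram iinj two_F hq hint.
have qR (R : comNzRingType) (u : {rmorphism A -> R}) x :
  qext u q x = bilin (map_mx u G) x x := quad_gram u x G_sym Gd G2.
have qVE x : qV iota q x = bilin (map_mx iota G) x x := qR _ iota x.
have qE x : q x = bilin G x x.
  have e m' n' (M : 'M[A]_(m', n')) : map_mx idfun M = M by exact: map_mx_id.
  rewrite (quadratic_form_quad hq) -[in RHS](e _ _ G) -(qR _ idfun).
  rewrite /qext /quad; congr (_ + _); apply: eq_bigr => j _.
  by apply: eq_bigr => l _; rewrite mxE.
(* Nondegeneracy makes the Gram determinant nonzero; the exponent [N] bounds the indices with
   nontrivial B_i/Z_i. *)
have [N [b detG]] : exists N b, \det G * b = 2 ^+ N.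
  apply: (dvd_pow2 hQ2 hA); apply/eqP => det0.
  have /eqP/det0P[v v0 vG] : \det (map_mx iota G) = 0 by rewrite det_map_mx det0 rmorph0.
  case/eqP: v0; apply: trmx_inj; rewrite trmx0; apply: hnd => y.
  by rewrite (bVE two_F G_sym qVE) /bilin trmxK vG mul0mx mxE.
have dtriv := Vbar_trivial two_F two_A iinj G_sym qVE hbeta detG.
pose K' : fieldType := {fraction {poly K}}.
pose j : {rmorphism K -> K'} := @FracField.tofrac {poly K} \o polyC.
pose theta : {rmorphism k -> K'} := j \o w.
have char_K' : 2 = 0 :> K' by rewrite -(rmorph_nat theta) char_k rmorph0.
have ntriv : exists t : K', t != 0 /\ t != 1.
  exists (FracField.tofrac 'X); rewrite tofrac_eq0 polyX_eq0; split=> //.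
  rewrite -tofrac1 tofrac_eq; apply/eqP => /(congr1 (fun p : {poly K} => size p)).
  by rewrite size_polyX size_poly1.
pose dat i := exists_basis_data two_F two_A iinj G_sym qVE (hbeta i).
pose omega i := proj1_sig (constructive_indefinite_description _ (dat i)).
have omegaP i : exists D, basis_data G i (beta i) (omega i) D.
  by rewrite /omega; case: constructive_indefinite_description.
pose D i := proj1_sig (constructive_indefinite_description _ (omegaP i)).
have datP i : basis_data G i (beta i) (omega i) (D i).
  by rewrite /D; case: constructive_indefinite_description.
clearbody D omega.
pose h i := (omega i)^T *m beta i.
have hs i : (h i)^T = h i by case: (datP i).
have hD i t : (h i) t t = 2 * D i t by case: (datP i).
pose H i := map_mx theta (map_mx pi (h i)).
pose Q i := quad (theta \o (pi \o D i)) (H i).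
have hsK i : (map_mx pi (h i))^T = map_mx pi (h i) by rewrite map_trmx hs.
have hDK i t : map_mx pi (h i) t t = 2 * (pi \o D i) t.
  by rewrite mxE hD rmorphM rmorph_nat.
have HS i : (H i)^T = H i by rewrite /H map_trmx hsK.
have HD i t : H i t t = 2 * (theta \o (pi \o D i)) t.
  by rewrite /H mxE hDK rmorphM rmorph_nat.
have ns i : nonsingular (theta \o (pi \o D i)) (H i).
  apply: nonsingular_ext => //.
  exact: (residue_nonsingular two_F G_sym qE qVE hk (hbeta i) (datP i)).
have iso i x : Q i (map_mx j (g i) *m x) = Q i x.
  have [[_ gq] _] := hg i.
  have gq' y : quad (w \o (pi \o D i)) (map_mx w (map_mx pi (h i))) (g i *m y) =
               quad (w \o (pi \o D i)) (map_mx w (map_mx pi (h i))) y.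
    by have := gq y; rewrite !(qext_qbar qE hk (datP i) _ _ (hqbar i)).
  have QE y : Q i y = quad (j \o (w \o (pi \o D i)))
      (map_mx j (map_mx w (map_mx pi (h i)))) y.
    by apply: eq_quad => //; apply/matrixP => a c; rewrite !mxE.
  rewrite !QE; apply: quad_isometry_ext => //; first by rewrite map_trmx hsK.
  by move=> t; rewrite mxE hDK rmorphM rmorph_nat.
have gen i := refl_gen_support (isometry_refl_gen char_K' ntriv
  (quadD (HS i) (HD i)) (quadZ _ _) (ns i) (iso i)).
pose l i := proj1_sig (constructive_indefinite_description _ (gen i)).
have lP i := proj2_sig (constructive_indefinite_description _ (gen i)).
have [R [u [rho [rho_u reg runit rsurj]]]] :=
  exists_residue_lift (theta \o pi) (flatten (mkseq l N.+2)).
have lift_g i : (i < N.+2)%N ->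
    lifts iota q G beta u rho i (map_mx j (g i)).
  move=> hi; apply: (lifts_isometry two_F two_prime iinj G_sym qVE hbeta rho_u
    runit (datP i) _ (lP i)).
  move=> x xl; apply: rsurj; apply/flattenP; exists (l i) => //.
  by apply/mapP; exists i => //; rewrite mem_iota.
have [m [lm am]] := lifts_family lift_g.
have [sm im [r dm]] := lm.
have uflat : flat u by apply: (torsion_free_flat hQ2 hA hunr).
have [sflat uM umod] := hM.
have mM : Mpt iota q u m by apply: Mpt_mspan.
have [f [fs fm _]] := umod R u uflat m mM.
exists K', j, (rho \o f : {rmorphism AM -> K'}); split.
  split=> [a /=||a /= ha].
  - by have /= -> := fs a; rewrite rho_u.
  - by exists (rho r); rewrite /= -det_map_mx fm -rmorphM dm rmorph1.
  (* [m] is a point of G over the flat algebra [R], so [f] kills the ideal of G by its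
     definition. *)
  - rewrite (ha R u f uflat fs) ?rmorph0 // fm; split; first by split=> //; exists r.
    move=> x; rewrite !qR /bilin trmx_mul !mulmxA.
    by rewrite -(mulmxA x^T) -(mulmxA x^T) im.
move=> i.
(* The universal matrix preserves (B_i)_AM, so its action on each column of [beta] can be written in
   [beta] modulo Z_i. *)
have hc t : exists c, base_change iota s 0 (latZ iota q i)
    (col t (univ *m map_mx s (beta i)) - map_mx s (beta i) *m c).
  apply: (base_change_latB (hbeta i)).
  rewrite colE -mulmxA -colE; have [[_ uB _] _ _] := uM i.
  have sc : scaled_in_L iota 0 (latB iota q i).
    by move=> x [[Lx _] _]; rewrite expr0 scale1r.
  apply: uB => //.
  have -> : col t (map_mx s (beta i)) = 1 *: map_mx s (col t (beta i)).
    by rewrite scale1r map_col.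
  apply: (base_change_gen s _ (latB_col (hbeta i) t)).
  by rewrite expr0 scale1r.
have [c cE] := fin_all_exists hc.
pose C := \matrix_(a, t) c t a 0.
have CP t : base_change iota s 0 (latZ iota q i)
    (col t (univ *m map_mx s (beta i) - map_mx s (beta i) *m C)).
  have -> : col t (univ *m map_mx s (beta i) - map_mx s (beta i) *m C) =
      col t (univ *m map_mx s (beta i)) - map_mx s (beta i) *m c t.
    apply/matrixP => a o; rewrite ord1 !mxE; congr (_ - _).
    by apply: eq_bigr => e _; rewrite !mxE.
  exact: cE.
exists C; split=> //.
(* Beyond the bound the matrices are empty; below it, C pushed to [R] and the lifted matrix both
   describe the action of [m]. *)
case: (leqP N.+2 i) => hi.
  by apply/matrixP => a; have := ltn_ord a; rewrite {2}(dtriv i hi).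
have [C' aC' <-] : exists2 C', acts iota q beta u i m C' & map_mx rho C' = map_mx j (g i).
  by have [am1 _] := am i; apply: am1.
rewrite [RHS]map_mx_comp.
apply: (acts_lifted_unique two_F two_A iinj G_sym qVE hk hbeta rho_u (datP i)
  (ns i) reg aC').
move=> t; have := base_change_map (fs : f \o s =1 u) (CP t).
have sE m' n' (M : 'M[A]_(m', n')) : map_mx f (map_mx s M) = map_mx u M.
  by apply/matrixP => a e; rewrite !mxE; apply: fs.
by rewrite map_col map_mxB !map_mxM fm !sE.
Qed.
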